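(* Let $t$ be a rational integer congruent to $3$ modulo $7$, or to $-17$, $-5$, $5$, $7$ or $13$ modulo $49$, or to $743$ modulo $2401$. If the polynomial $$Y^3-tY^2-(2t^2-7t+21)Y+t^3+28$$ is irreducible over $\mathbb{Q}$, then for $y$ a root of it, $\mathbb{Q}(y)$ is a cyclic extension of $\mathbb{Q}$; and if $$p(x)=x^7-7tx^5-7(t^2-4t+11)x^4+28(t^2-t+3)x^3+7(3t^2-13t+36)tx^2+7(t^4-18t^3+68t^2-176t+192)x-t^5-23t^4+184t^3-816t^2+1536t-2304$$ is likewise irreducible over $\mathbb{Q}$, then the splitting field of $p(x)$ over $K=\mathbb{Q}(\sqrt{-7(t-1)^2-28},\,y)$ is an unramified cyclic extension of $K$.
   Context: A cyclic extension is a Galois extension with cyclic Galois group. *)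

(* Defs.v *)
From HB Require Import structures.
From mathcomp Require Import all_boot all_order all_algebra all_fingroup
  all_solvable all_field.
From mathcomp Require Import classical_sets.

Set Implicit Arguments.
Unset Strict Implicit.
Unset Printing Implicit Defensive.

Import Order.TTheory GRing.Theory Num.Theory.
Local Open Scope classical_set_scope.
Local Open Scope ring_scope.

Definition cubic (t : int) : {poly int} :=
  'X^3 - t%:P * 'X^2 - (2 * t ^+ 2 - 7 * t + 21)%:P * 'X
  + (t ^+ 3 + 28)%:P.

Definition septic (t : int) : {poly int} :=
  'X^7 - (7 * t)%:P * 'X^5
  - (7 * (t ^+ 2 - 4 * t + 11))%:P * 'X^4
  + (28 * (t ^+ 2 - t + 3))%:P * 'X^3
  + (7 * (3 * t ^+ 2 - 13 * t + 36) * t)%:P * 'X^2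
  + (7 * (t ^+ 4 - 18 * t ^+ 3 + 68 * t ^+ 2 - 176 * t + 192))%:P * 'X
  + (- t ^+ 5 - 23 * t ^+ 4 + 184 * t ^+ 3 - 816 * t ^+ 2 + 1536 * t
     - 2304)%:P.

(* Number fields are the subfields of an ambient finite normal extension L of
   rat; ideals of their rings of integers are subsets of L. *)
Section NumberFields.

Variable L : splittingFieldType rat.
Implicit Types (K E : {subfield L}) (I J p q : set L).

Definition cyclic_extension K E : Prop := galois K E /\ cyclic 'Gal(E / K).

Definition ring_of_integers E : set L :=
  [set x | x \in E /\ integralOver (intr : int -> L) x].

Definition ideal E I : Prop :=
  [/\ I `<=` ring_of_integers E,
      I 0,
      forall x y, I x -> I y -> I (x + y)
    & forall a x, ring_of_integers E a -> I x -> I (a * x)].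

Definition prime_ideal E I : Prop :=
  [/\ ideal E I,
      ~ I 1
    & forall x y, ring_of_integers E x -> ring_of_integers E y ->
        I (x * y) -> I x \/ I y].

Definition ideal_mul I J : set L :=
  [set x | exists n (a b : 'I_n -> L),
    [/\ forall i, I (a i), forall i, J (b i) & x = \sum_i a i * b i]].

Definition ideal_exp E I (n : nat) : set L :=
  iter n (ideal_mul I) (ring_of_integers E).

(* e is the exponent of q in the ideal of the ring of integers of E generated
   by the prime of K below q. *)
Definition ramification_index K E q (e : nat) : Prop :=
  let p := q `&` ring_of_integers K in
  let pE := ideal_mul (ring_of_integers E) p in
  pE `<=` ideal_exp E q e /\ ~ (pE `<=` ideal_exp E q e.+1).

Definition unramified_at_finite_places K E : Prop :=
  forall q, prime_ideal E q -> (exists2 x, q x & x != 0) ->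
    ramification_index K E q 1.

(* No complex place of E lies above a real place of K. *)
Definition unramified_at_infinite_places K E : Prop :=
  forall f : {rmorphism subvs_of E -> algC},
    (forall x : subvs_of E, vsval x \in K -> f x \is Num.real) ->
    forall x : subvs_of E, f x \is Num.real.

(* Residue fields are finite, hence perfect, so e = 1 is the only condition at
   a finite place. *)
Definition unramified_extension K E : Prop :=
  unramified_at_finite_places K E /\ unramified_at_infinite_places K E.

End NumberFields.

(* Main.v *)
(* Number the roots x_0, ..., x_6 of the septic cyclically, with indices mod 7.  The
   product x_0 * x_j is a combination of 1, x_0, ..., x_6 whose coefficients are
   explicit in K, so multiplication by x_0 is an explicit matrix M over K; since M
   commutes with its conjugates under the cyclic shift, K(x) contains all the roots
   as soon as it contains one root x.  As 7 does not divide [K : Q], the splitting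
   field E = K(x) is cyclic of degree 7 over K.

   If a prime q of E is ramified, its inertia group is the whole Galois group and
   all roots are congruent mod q.  Their sum is 0, so outside 7 they would all lie
   in q, and the coefficients of the septic would force 11 and 12 into q.  At 7 the
   congruences on t give an integer n such that, in the Newton polygon of
   p(X + n), six roots have the same positive slope and the seventh a larger one,
   which is incompatible with all roots being congruent.

   At the infinite places, complex conjugation would induce an element of order at
   most 2 in a group of odd order. *)

From Stdlib Require Import ZArith.
Require Import Defs.
From mathcomp Require Import all_boot all_order all_algebra all_fingroup
  all_solvable all_field.
From mathcomp Require Import boolp classical_sets.
From mathcomp Require Import zify ring ssrZ.

Import Order.TTheory GRing.Theory Num.Theory.
Local Open Scope ring_scope.

(** * Rings of integers and their prime ideals *)

(** The ramification index is a pair of inclusions between ideals, so no factorisation of ideals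
    enters. At a prime [q] where every nontrivial automorphism moves some integer modulo [q], a
    combination of traces shows that a suitable multiple of each element of [q] lies in the ideal
    generated by [q] intersected with the base, the multiplier being invertible modulo [q].
    Nakayama's lemma provides an element of [q] outside the square of [q], and together these
    exclude exponent 2.

    The matrix [M] is handled formally: no cyclic order of the actual roots is known beforehand. The
    row of the element 1 is a cyclic vector for [M] with annihilator the septic, so the row space is
    [K[X]/(p)], and a matrix commuting with [M] is a polynomial in [M]. That polynomial, evaluated
    at a root, gives another root. The identities needed for [M] have entries in [Z[t]] with respect
    to an explicit basis of [K]; they are checked by computation, for all [t] at once. *)

Section RingOfIntegers.

Context {L : splittingFieldType rat} (E : {subfield L}).
Local Notation O := (ring_of_integers E).

Lemma oi_mem x : O x -> x \in E. Proof. by case. Qed.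

Lemma oi_int (m : int) : O m%:~R.
Proof. by split; [exact: rpred_int | exact: integral_id]. Qed.

Lemma oi_nat n : O n%:R. Proof. exact: (oi_int n). Qed.

Lemma oi0 : O 0. Proof. exact: (oi_nat 0). Qed.
Lemma oi1 : O 1. Proof. exact: (oi_nat 1). Qed.

Lemma oiD x y : O x -> O y -> O (x + y).
Proof. by move=> [xE xI] [yE yI]; split; [exact: rpredD | exact: integral_add]. Qed.

Lemma oiM x y : O x -> O y -> O (x * y).
Proof. by move=> [xE xI] [yE yI]; split; [exact: rpredM | exact: integral_mul]. Qed.

Lemma oiN x : O x -> O (- x).
Proof. by move=> [xE xI]; split; [exact: rpredNr | exact: integral_opp]. Qed.

Lemma oiB x y : O x -> O y -> O (x - y).
Proof. by move=> Ox /oiN Oy; exact: oiD. Qed.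

Lemma oiX x n : O x -> O (x ^+ n).
Proof.
by move=> Ox; elim: n => [|n IHn]; rewrite ?expr0 ?exprS; [exact: oi1 | exact: oiM].
Qed.

Lemma oi_sum I (r : seq I) (P : pred I) F :
  (forall i, P i -> O (F i)) -> O (\sum_(i <- r | P i) F i).
Proof. by move=> OF; elim/big_ind: _ => //; [exact: oi0 | exact: oiD]. Qed.

Lemma oi_prod I (r : seq I) (P : pred I) F :
  (forall i, P i -> O (F i)) -> O (\prod_(i <- r | P i) F i).
Proof. by move=> OF; elim/big_ind: _ => //; [exact: oi1 | exact: oiM]. Qed.

Lemma oi_horner (P : {poly int}) a : O a -> O (map_poly intr P).[a].
Proof.
move=> Oa; rewrite horner_coef; apply: oi_sum => i _.
by rewrite coef_map; apply: oiM; [exact: oi_int | exact: oiX].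
Qed.

Lemma oi_root_exp x n : x \in E -> (0 < n)%N -> O (x ^+ n) -> O x.
Proof.
move=> xE n_gt0 [_ xnI]; split=> //.
apply: (integral_root_monic (monicXnsubC (x ^+ n) n_gt0)) => [|y].
  by rewrite /root hornerD hornerN hornerXn hornerC subrr.
move: y; apply/integral_poly=> i; rewrite coefB coefXn coefC.
apply: integral_sub; first by case: (i == n); [exact: integral1 | exact: integral0].
by case: (i == 0)%N => //; exact: integral0.
Qed.

End RingOfIntegers.

Arguments oi_mem {L E x}.

Section PrimeIdeal.

Context {L : splittingFieldType rat} {E : {subfield L}} {q : set L}.
Local Notation O := (ring_of_integers E).
Hypothesis qP : prime_ideal E q.

Lemma pideal_sub x : q x -> O x. Proof. by case: qP => -[h _ _ _] _ _; exact: h. Qed.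
Lemma pideal0 : q 0. Proof. by case: qP => -[]. Qed.
Lemma pidealD x y : q x -> q y -> q (x + y).
Proof. by case: qP => -[_ _ h _] _ _; exact: h. Qed.
Lemma pidealMl a x : O a -> q x -> q (a * x).
Proof. by case: qP => -[_ _ _ h] _ _; exact: h. Qed.
Lemma pidealMr a x : O a -> q x -> q (x * a).
Proof. by rewrite mulrC; exact: pidealMl. Qed.
Lemma pidealN x : q x -> q (- x).
Proof. by rewrite -mulN1r; apply: pidealMl; apply: oiN; exact: oi1. Qed.
Lemma pidealB x y : q x -> q y -> q (x - y).
Proof. by move=> qx /pidealN; exact: pidealD. Qed.
Lemma pideal1 : ~ q 1. Proof. by case: qP. Qed.
Lemma pideal_prime x y : O x -> O y -> q (x * y) -> q x \/ q y.
Proof. by case: qP => _ _; exact. Qed.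

Lemma pideal_sum I (r : seq I) (P : pred I) F :
  (forall i, P i -> q (F i)) -> q (\sum_(i <- r | P i) F i).
Proof. by move=> qF; elim/big_ind: _ => //; [exact: pideal0 | exact: pidealD]. Qed.

Lemma pideal_prod (I : eqType) (r : seq I) F : {in r, forall i, O (F i)} ->
  q (\prod_(i <- r) F i) -> exists2 i, i \in r & q (F i).
Proof.
elim: r => [|i r IHr] OF; first by rewrite big_nil => /pideal1.
have OFr : {in r, forall j, O (F j)} by move=> j jr; apply: OF; rewrite inE jr orbT.
rewrite big_cons => /pideal_prime[||qF|/IHr[//|j jr qj]].
- by apply: OF; rewrite mem_head.
- by rewrite big_seq; apply: oi_prod.
- by exists i; rewrite ?mem_head.
by exists j; rewrite // inE jr orbT.
Qed.

Lemma pideal_exp x n : O x -> q (x ^+ n) -> q x.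
Proof.
move=> Ox; elim: n => [/pideal1 //|n IHn].
by rewrite exprS => /pideal_prime[]//; apply: oiX.
Qed.

Lemma pideal_coprime (m n : int) : q m%:~R -> q n%:~R -> coprimez m n -> False.
Proof.
move=> qm qn /coprimezP[[u v] /= uv1]; apply: pideal1.
have -> : (1 : L) = (u * m + v * n)%:~R by rewrite uv1.
by rewrite rmorphD !rmorphM; apply: pidealD; apply: pidealMl => //; exact: oi_int.
Qed.

(** The witness is the lowest nonzero coefficient of [P]: powers of [X] can be divided out because
    [x] is nonzero, and then the constant term is a multiple of [x]. *)
Lemma pideal_root_int (P : {poly int}) x :
  q x -> x != 0 -> P != 0 -> root (map_poly intr P) x ->
  exists2 c : int, c != 0 & q c%:~R.
Proof.
move=> qx x_neq0; elim/poly_ind: P => [|P c IHP]; first by rewrite eqxx.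
move=> PXc_neq0; rewrite rmorphD rmorphM /= map_polyX map_polyC /root !hornerE /=.
case: (eqVneq c 0) PXc_neq0 => [-> | c_neq0] PXc_neq0.
  rewrite addr0 mulf_eq0 (negPf x_neq0) orbF => Px0; apply: IHP => //.
  by apply: contraNneq PXc_neq0 => ->; rewrite mul0r add0r.
rewrite addrC addr_eq0 => /eqP c_eq; exists c => //; rewrite c_eq.
by apply/pidealN/pidealMl => //; apply: oi_horner; exact: pideal_sub.
Qed.

End PrimeIdeal.

Section ResidueField.

Context {L : splittingFieldType rat} {E : {subfield L}} {q : set L}.
Local Notation O := (ring_of_integers E).
Hypothesis qP : prime_ideal E q.

(** The least positive integer in [q] is prime, since [q] contains one factor of any factorisation
    of it. *)
Lemma pideal_char : (exists2 x, q x & x != 0) -> exists2 l, prime l & q l%:R.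
Proof.
case=> x qx x_neq0; have [xE [P P_monic Px0]] := pideal_sub qP _ qx.
have [c c_neq0 qc] := pideal_root_int qP _ _ qx x_neq0 (monic_neq0 P_monic) Px0.
have ex_n : exists n, (0 < n)%N && `[< q n%:R >].
  exists `|c|%N; rewrite absz_gt0 c_neq0; apply/asboolP.
  rewrite -[_%:R]/((`|c|%N : int)%:~R) abszE; case: ger0P => // _.
  by rewrite rmorphN; exact: (pidealN qP).
have [l /andP[l_gt0 /asboolP ql] l_min] := ex_minnP ex_n.
exists l => //; apply/primeP; split=> [|d /dvdnP[k l_eq]].
  by case: l l_gt0 ql {l_min} => [//|[|l]] // _ /(pideal1 qP).
have /andP[k_gt0 d_gt0] : (0 < k)%N && (0 < d)%N by rewrite -muln_gt0 -l_eq.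
have := ql; rewrite l_eq natrM => /(pideal_prime qP _ _ (oi_nat E k) (oi_nat E d)) [qk|qd].
  have : (l <= k)%N by apply: l_min; rewrite k_gt0; apply/asboolP.
  by rewrite l_eq; case: d d_gt0 {l_eq} => [|[|d]] // _; rewrite -{2}[k]muln1 leq_pmul2l.
have : (l <= d)%N by apply: l_min; rewrite d_gt0; apply/asboolP.
move=> le_ld; apply/orP; right; rewrite -l_eq eqn_leq le_ld andbT.
by rewrite l_eq leq_pmull.
Qed.

Lemma residue_inv a : (exists2 x, q x & x != 0) -> O a -> ~ q a ->
  exists2 w, O w & q (1 - a * w).
Proof.
move=> /pideal_char[l l_pr ql] Oa nqa; have [_ [P P_monic Pa0]] := Oa.
have ql' : q (l : int)%:~R by [].
have: exists i, ~~ (l %| P`_i)%Z.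
  exists (size P).-1; rewrite -[P`_ _]/(lead_coef P) (monicP P_monic).
  by rewrite dvdzE /= dvdn1; apply: contraTneq l_pr => ->.
have: q (map_poly intr P).[a] by rewrite (rootP Pa0); exact: pideal0 qP.
elim/poly_ind: P {P_monic Pa0} => [|P c IHP] qPa [i].
  by rewrite coef0 dvdz0.
have {}qPa : q ((map_poly intr P).[a] * a + c%:~R).
  by move: qPa; rewrite rmorphD rmorphM /= map_polyX map_polyC !hornerE.
have [/dvdzP[m c_eq] li | lc _] := boolP (l %| c)%Z; last first.
  have: coprimez l c by rewrite coprimezE prime_coprime.
  case/coprimezP=> -[u v] /= uv1.
  exists (- (map_poly intr P).[a] * v%:~R).
    apply: oiM (oi_int E v); apply: oiN; exact: oi_horner.
  have eq1 : 1 = u%:~R * (l : int)%:~R + v%:~R * c%:~R :> L.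
    by rewrite -!rmorphM -rmorphD uv1.
  have -> : 1 - a * (- (map_poly intr P).[a] * v%:~R)
     = u%:~R * l%:~R + v%:~R * ((map_poly intr P).[a] * a + c%:~R) :> L.
    by rewrite [LHS](congr1 (fun z => z - _) eq1); ring.
  by apply: (pidealD qP); apply: (pidealMl qP) => //; exact: oi_int.
apply: IHP.
  move: qPa; rewrite c_eq intrM => /(pidealB qP) /(_ (pidealMl qP _ _ (oi_int E m) ql')).
  rewrite addrK.
  by case/(pideal_prime qP _ _ (oi_horner E P a Oa) Oa).
case: i li => [|i]; rewrite c_eq coefD coefMX coefC /= ?add0r ?dvdz_mull //.
by rewrite addr0; exists i.
Qed.

End ResidueField.

Lemma rat_dep (L : fieldExtType rat) k (x : 'I_k -> L) : (\dim {:L} < k)%N ->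
  exists2 c : 'I_k -> int, (exists i, c i != 0) & \sum_i (c i)%:~R * x i = 0.
Proof.
move=> lt_k; pose X := [tuple x i | i < k].
have nfree : ~~ free X.
  by rewrite /free neq_ltn (leq_ltn_trans (dimvS (subvf _))) // size_tuple.
have [c c_sum [i c_neq0]] : exists2 c : 'I_k -> rat,
    \sum_i c i *: x i = 0 & exists i, c i != 0.
  apply: contrapT => no_c; case/negP: nfree; apply/freeP => c c_sum i.
  apply: contrapT => /eqP c_neq0; apply: no_c; exists c; last by exists i.
  by rewrite -[RHS]c_sum; apply: eq_bigr => j _; rewrite -tnth_nth tnth_mktuple.
exists (fun i => numq (c i) * \prod_(j | j != i) denq (c j)).
  exists i; rewrite mulf_neq0 ?numq_eq0 //; apply/prodf_neq0 => j _.
  exact: denq_neq0.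
transitivity ((\prod_j denq (c j))%:~R *: (\sum_i c i *: x i)); last first.
  by rewrite c_sum scaler0.
rewrite scaler_sumr; apply: eq_bigr => j _; rewrite scalerA mulrzl -scaler_int.
by congr (_ *: _); rewrite [in RHS](bigD1 j) //= !intrM numqE; ring.
Qed.

(** Dividing all entries by [l] lowers the sum of their absolute values, so this can be repeated
    only finitely often. It turns a rational dependence into one that is nontrivial modulo [l]. *)
Lemma int_vec_primitive (l : nat) k (c : 'I_k -> int) : prime l ->
  (exists i, c i != 0) -> exists2 c' : 'I_k -> int,
    (exists i, ~~ (l %| c' i)%Z) & exists2 m : int, m != 0 & forall i, c i = m * c' i.
Proof.
move=> l_pr; have [n] := ubnP (\sum_i `|c i|)%N; elim: n c => // n IHn c le_n [i ci].
have [/existsP[j lj] | /existsPn l_all] := boolP [exists i, ~~ (l %| c i)%Z].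
  by exists c; [exists j | exists 1 => // j'; rewrite mul1r].
have l_neq0 : (l : int) != 0 by rewrite eqz_nat -lt0n prime_gt0.
have cE j : c j = (c j %/ l)%Z * l by rewrite divzK //; have:= l_all j; rewrite negbK.
have ci' : (c i %/ l)%Z != 0 by apply: contraNneq ci => ci0; rewrite cE ci0 mul0r.
have [|| c' c'_ndiv [m m_neq0 c'E]] := IHn (fun j => (c j %/ l)%Z).
- rewrite (leq_trans _ (_ : \sum_i `|c i| <= n)%N) //.
  rewrite [X in (X < _)%N](bigD1 i) // [X in (_ < X)%N](bigD1 i) //=.
  rewrite -addSn leq_add //.
    by rewrite [X in (_ < `|X|)%N]cE abszM ltn_Pmulr ?absz_gt0 // prime_gt1.
  by apply: leq_sum => j _; rewrite [X in (_ <= `|X|)%N]cE abszM leq_pmulr ?prime_gt0.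
- by exists i.
exists c' => //; exists (m * l) => [|j]; first by rewrite mulf_neq0.
by rewrite cE c'E mulrAC.
Qed.

Lemma intr_ext_eq0 (L : fieldExtType rat) (m : int) : (m%:~R == 0 :> L) = (m == 0).
Proof. by rewrite -(rmorph_int (in_alg L)) fmorph_eq0 intr_eq0. Qed.

(** * Finite generation of a prime ideal, and its square *)

Section Nakayama.

Context {L : splittingFieldType rat} {E : {subfield L}} {q : set L}.
Local Notation O := (ring_of_integers E).
Hypothesis qP : prime_ideal E q.
Hypothesis q_neq0 : exists2 x, q x & x != 0.

(* A family of elements of [q] that is maximal among those independent mod [l]
   generates [q] together with [l]; its size is bounded by [\dim {:L}]. *)
Lemma pideal_fin_gen : exists k (x : 'I_k -> L), (forall i, q (x i)) /\
  forall z, q z -> exists2 c : 'I_k -> L, (forall i, O (c i)) & z = \sum_i c i * x i.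
Proof.
have [l l_pr ql] := pideal_char qP q_neq0.
have l_neq0 : (l : int) != 0 by rewrite eqz_nat -lt0n prime_gt0.
pose indep k (x : 'I_k -> L) := forall n : 'I_k -> int,
  (exists2 z, O z & \sum_i (n i)%:~R * x i = l%:R * z) -> forall i, (l %| n i)%Z.
have indep_le k x : indep k x -> (k <= \dim {:L})%N.
  move=> x_indep; rewrite leqNgt; apply/negP => /(rat_dep _ _ x)[c c_neq0 c_sum].
  have [c' [i /negP c'i] [m m_neq0 cE]] := int_vec_primitive _ _ _ l_pr c_neq0.
  apply: c'i; apply: x_indep; exists 0; first exact: oi0.
  rewrite mulr0; apply/eqP; rewrite -(mulrI_eq0 _ (x := m%:~R)).
    rewrite mulr_sumr -[X in _ == X]c_sum; apply/eqP/eq_bigr => j _.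
    by rewrite mulrA -intrM cE.
  by apply: lregP; rewrite intr_ext_eq0.
have ex_k : exists k, `[< exists2 x : 'I_k -> L, forall i, q (x i) & indep k x >].
  by exists 0; apply/asboolP; exists (fun=> 0) => [[]|n _ []].
have ub_k k : `[< exists2 x : 'I_k -> L, forall i, q (x i) & indep k x >] ->
    (k <= \dim {:L})%N.
  by case/asboolP=> x _; exact: indep_le.
have [k /asboolP[x qx x_indep] k_max] := ex_maxnP ex_k ub_k.
exists k.+1, (fun i => oapp x l%:R (unlift ord0 i)); split=> [i|z qz].
  by case: unliftP => [j _|_] /=.
(* The family [x] with [z] put in front is too long to be independent modulo [l]. *)
pose y i := oapp x z (unlift (@ord0 k) i).
have qy i : q (y i) by rewrite /y; case: unliftP => [j _|_] /=.
have /existsNP[n /not_implyP[[w Ow n_sum] /existsNP[i ni]]] : ~ indep _ y.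
  move=> y_indep; have : (k.+1 <= k)%N by apply: k_max; apply/asboolP; exists y.
  by rewrite ltnn.
move: n_sum; rewrite big_ord_recl {1}/y unlift_none /= => n_sum.
have {n_sum} n_sum : (n ord0)%:~R * z + \sum_(j < k) (n (lift ord0 j))%:~R * x j
    = l%:R * w.
  by rewrite -n_sum; congr (_ + _); apply: eq_bigr => j _; rewrite /y liftK.
have n0 : ~~ (l %| n ord0)%Z.
  apply/negP => /dvdzP[m n0E]; apply: ni.
  have n_dvd j : (l %| n (lift ord0 j))%Z.
    apply: (x_indep (fun j => n (lift ord0 j))); exists (w - m%:~R * z).
      by apply: oiB => //; apply: oiM; [exact: oi_int | exact: pideal_sub qz].
    rewrite mulrBr -n_sum n0E intrM; ring.
  by case: (unliftP ord0 i) => [j ->|->] //; rewrite n0E dvdz_mull.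
(* The coefficient of [z] is prime to [l], so [z = u * l * z + v * n ord0 * z], and the dependence
   replaces [n ord0 * z] by a multiple of [l] plus a combination of the [x j]. *)
have [[u v] /= uv1] : exists uv : int * int, uv.1 * (l : int) + uv.2 * n ord0 = 1.
  by apply/coprimezP; rewrite coprimezE prime_coprime.
exists (fun i => oapp (fun j => - (v * n (lift ord0 j))%:~R)
                  (v%:~R * w + u%:~R * z) (unlift ord0 i)).
  move=> j; case: unliftP => [j' _|_] /=; first by apply: oiN; exact: oi_int.
  by apply: oiD; apply: oiM; first [exact: oi_int | exact: Ow | exact: pideal_sub qz].
rewrite big_ord_recl !unlift_none /=.
set T := \sum_(j < k) (n _)%:~R * x j in n_sum.
have TE : T = l%:R * w - (n ord0)%:~R * z by rewrite -n_sum addrC addKr.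
have -> : \sum_(j < k) oapp (fun j => - (v * n (lift ord0 j))%:~R)
    (v%:~R * w + u%:~R * z) (unlift ord0 (lift ord0 j))
    * oapp x l%:R (unlift ord0 (lift ord0 j)) = - (v%:~R * T).
  rewrite mulr_sumr -sumrN; apply: eq_bigr => j _; rewrite !liftK /= intrM; ring.
have zE : z = (u * (l : int) + v * n ord0)%:~R * z by rewrite uv1 mul1r.
rewrite {1}zE TE intrD !intrM; ring.
Qed.

(** Nakayama's determinant trick: if [q] were its own square, the generators would satisfy [x = C x]
    with [C] over [q], so [1 - C] would be singular. But its determinant is 1 modulo [q]: the
    diagonal product is, and every other permutation meets an off-diagonal entry, which is in
    [q]. *)
Lemma pideal_sqr_proper : exists2 x, q x & ~ ideal_mul q q x.
Proof.
have [k [x [qx x_gen]]] := pideal_fin_gen.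
apply: contrapT => no_x.
have q_sqr z : q z -> exists2 c : 'I_k -> L, (forall i, q (c i)) & z = \sum_i c i * x i.
  move=> qz; have [n [a [b [qa qb ->]]]] : ideal_mul q q z.
    by apply: contrapT => nqz; apply: no_x; exists z.
  have /choice[c' c'P] : forall j, exists c : 'I_k -> L, (forall i, O (c i)) /\
      b j = \sum_i c i * x i by move=> j; have [d ? ?] := x_gen _ (qb j); exists d.
  exists (fun i => \sum_j a j * c' j i).
    by move=> i; apply: (pideal_sum qP) => j _; apply: (pidealMr qP); case: (c'P j).
  under [RHS]eq_bigr do rewrite mulr_suml.
  rewrite exchange_big /=; apply: eq_bigr => j _; rewrite (c'P j).2 mulr_sumr.
  by apply: eq_bigr => i _; rewrite mulrA.
have /choice[C CP] : forall i, exists c : 'I_k -> L, (forall j, q (c j)) /\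
    x i = \sum_j c j * x j by move=> i; have [d ? ?] := q_sqr _ (qx i); exists d.
pose A := 1%:M - \matrix_(i, j) C i j.
pose X := \col_i x i.
have AX0 : A *m X = 0.
  apply/matrixP => i j; rewrite mulmxBl mul1mx !mxE {1}(CP i).2.
  by apply/eqP; rewrite subr_eq0; apply/eqP/eq_bigr => m _; rewrite !mxE.
have detA : \det A = 0.
  apply/eqP; apply: contraT => detA.
  have A_unit : A \in unitmx by rewrite unitmxE unitfE.
  have X0 : X = 0 by rewrite -(mulKmx A_unit X) AX0 mulmx0.
  case: q_neq0 => z /x_gen[c _ ->] /eqP[]; apply: big1 => i _.
  by have := congr1 (fun Y : 'cV_k => Y i 0) X0; rewrite !mxE => ->; rewrite mulr0.
have q_prod (r : seq 'I_k) : q (1 - \prod_(i <- r) A i i).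
  elim: r => [|i r IHr]; first by rewrite big_nil subrr; exact: pideal0 qP.
  rewrite big_cons.
  have Aii : A i i = 1 - C i i by rewrite /A !mxE eqxx.
  rewrite {}Aii; move: IHr; set Z := \prod_(j <- r) _ => IHr.
  have -> : 1 - (1 - C i i) * Z = (1 - Z) + C i i * Z by ring.
  apply: (pidealD qP) => //; apply: (pidealMr qP); last exact: (CP i).1.
  apply: oi_prod => j _; rewrite !mxE eqxx; apply: oiB; first exact: oi1.
  exact: pideal_sub qP _ ((CP j).1 j).
apply: (pideal1 qP); have -> : 1 = 1 - \det A by rewrite detA subr0.
rewrite /determinant (bigD1 1%g) //= odd_perm1 expr0 mul1r opprD addrA.
under eq_bigr do rewrite perm1.
apply: (pidealB qP); first exact: q_prod.
apply: (pideal_sum qP) => s s_neq1.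
have [i si] : exists i, s i != i.
  apply/existsP; rewrite -negb_forall; apply: contra s_neq1 => /forallP s1.
  by apply/eqP/permP => i; rewrite perm1; exact/eqP.
have O_A m n : O (A m n).
  rewrite !mxE; apply: oiB; first by case: eqP => _; [exact: oi1 | exact: oi0].
  exact: pideal_sub qP _ ((CP m).1 n).
apply: (pidealMl qP); first by apply/oiX/oiN/oi1.
rewrite (bigD1 i) //=; apply: (pidealMr qP); first by apply: oi_prod.
rewrite !mxE eq_sym (negPf si) sub0r; apply: (pidealN qP); exact: (CP i).1.
Qed.

End Nakayama.

(** * A prime with trivial inertia group is unramified *)

Section IdealMul.

Local Open Scope classical_set_scope.

Context {L : splittingFieldType rat}.
Implicit Types (I J : set L).

Lemma ideal_mul_prod I J x y : I x -> J y -> ideal_mul I J (x * y).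
Proof.
move=> Ix Jy; exists 1, (fun=> x), (fun=> y); split=> //.
by rewrite big_ord1.
Qed.

Lemma ideal_mulD I J x y : ideal_mul I J x -> ideal_mul I J y -> ideal_mul I J (x + y).
Proof.
move=> [m [a [b [Ia Jb ->]]]] [n [a' [b' [Ia' Jb' ->]]]].
pose cat (f : 'I_m -> L) (g : 'I_n -> L) i :=
  match split i with inl j => f j | inr j => g j end.
exists (m + n)%N, (cat a a'), (cat b b'); split=> [i|i|].
- by rewrite /cat; case: split.
- by rewrite /cat; case: split.
rewrite big_split_ord /=; congr (_ + _); apply: eq_bigr => i _; rewrite /cat.
  by rewrite (unsplitK (inl i)).
by rewrite (unsplitK (inr i)).
Qed.

Lemma ideal_mulMl I J c x : (forall a, I a -> I (c * a)) ->
  ideal_mul I J x -> ideal_mul I J (c * x).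
Proof.
move=> Ic [m [a [b [Ia Jb ->]]]]; exists m, (fun i => c * a i), b.
split=> // [i|]; first exact: Ic.
by rewrite mulr_sumr; apply: eq_bigr => i _; rewrite mulrA.
Qed.

Lemma ideal_mulS I I' J J' : I `<=` I' -> J `<=` J' -> ideal_mul I J `<=` ideal_mul I' J'.
Proof.
move=> sI sJ x [m [a [b [Ia Jb ->]]]]; exists m, a, b.
by split=> // i; [apply: sI | apply: sJ].
Qed.

Lemma ideal_mulC I J : ideal_mul I J `<=` ideal_mul J I.
Proof.
move=> x [m [a [b [Ia Jb ->]]]]; exists m, b, a; split=> //.
by apply: eq_bigr => i _; rewrite mulrC.
Qed.

End IdealMul.

Lemma oi_gal (L : splittingFieldType rat) (E : {subfield L}) (g : gal_of E) x :
  ring_of_integers E x -> ring_of_integers E (g x).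
Proof.
move=> [xE [P P_monic Px]]; split; first exact: memv_gal.
exists P => //; have := rmorph_root g Px.
rewrite -map_poly_comp (@eq_map_poly _ _ _ intr) // => m /=.
exact: rmorph_int.
Qed.

Section Ramification.

Local Open Scope classical_set_scope.

Context {L : splittingFieldType rat} {K E : {subfield L}} {q : set L}.
Local Notation O := (ring_of_integers E).
Hypothesis galKE : galois K E.
Hypothesis qP : prime_ideal E q.
Hypothesis q_neq0 : exists2 x, q x & x != 0.
Local Notation G := 'Gal(E / K)%G.

(** If [h c] in [q] always forces [c] in [q], the same holds for all powers of [h]. As [h] has
    finite order, [b] is the image of [h b] under a power of [h], so [h b] is in [q] whenever [b]
    is. *)
Lemma gal_decomposition (h : gal_of E) : h \in G ->
  (exists c, [/\ O c, ~ q c & q (h c)]) \/ (forall b, q b -> q (h b)).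
Proof.
move=> hG; have [|no_c] := EM (exists c, [/\ O c, ~ q c & q (h c)]); [by left | right].
have q_h m c : O c -> q ((h ^+ m)%g c) -> q c.
  elim: m c => [|m IHm] c Oc; first by rewrite expg0 gal_id.
  rewrite expgSr galM ?(oi_mem Oc) // => qhc; apply: IHm => //.
  apply: contrapT => nq; apply: no_c; exists ((h ^+ m)%g c); split=> //.
  exact: oi_gal.
move=> b qb; have Ob := pideal_sub qP _ qb; apply: (q_h #[h]%g.-1); first exact: oi_gal.
by rewrite -galM ?(oi_mem Ob) // -expgS prednK ?order_gt0 // expg_order gal_id.
Qed.

(* With [d := \prod_(tau != 1) (tau (z tau) - z tau)], expanding the product that
   vanishes on [G \ 1] writes [d * b] as a sum of traces [Tr (c * b)]. *)
Lemma ramification_index1 :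
  (forall tau, tau \in G -> tau != 1%g -> exists2 z, O z & ~ q (tau z - z)) ->
  ramification_index K E q 1.
Proof.
move=> inert; split.
  apply: (subset_trans (@ideal_mulC _ _ _)).
  by apply: ideal_mulS => // x [].
set pE := ideal_mul _ _; move=> pE_sub.
have pEMl c x : O c -> pE x -> pE (c * x).
  by move=> Oc; apply: ideal_mulMl => a; exact: oiM.
have /choice[z zP] : forall tau : gal_of E, exists z, O z /\
    (tau \in G -> tau != 1%g -> ~ q (tau z - z)).
  move=> tau; have [[tauG tau1]|ntau] := EM (tau \in G /\ tau != 1%g).
    by have [z Oz nqz] := inert _ tauG tau1; exists z.
  by exists 0; split=> [|tauG tau1]; [exact: oi0 | case: ntau].
(* [N] is the intersection of the conjugates of [q]; the trace of an element of [N] lies both in [q]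
   and in the base field. *)
pose N b := forall g : gal_of E, g \in G -> q (g b).
have NM a b : O a -> N b -> N (a * b).
  by move=> Oa Nb g gG; rewrite rmorphM; apply: (pidealMl qP); [exact: oi_gal | exact: Nb].
have trace_pE (r : seq (gal_of E)) b : N b ->
    pE (\sum_(g in G) (\prod_(tau <- r) (tau (z tau) - g (z tau))) * g b).
  elim: r b => [|tau r IHr] b Nb.
    under eq_bigr do rewrite big_nil mul1r.
    rewrite -[X in pE X]mul1r; apply: ideal_mul_prod; first exact: oi1.
    have qT : q (\sum_(g in G) g b) by apply: (pideal_sum qP).
    split=> //; split; last by case: (pideal_sub qP _ qT).
    apply: mem_galTrace => //; apply: (oi_mem); apply: (pideal_sub qP).
    by have := Nb 1%g (group1 _); rewrite gal_id.
  have -> : \sum_(g in G) (\prod_(s <- tau :: r) (s (z s) - g (z s))) * g b =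
      tau (z tau) * (\sum_(g in G) (\prod_(s <- r) (s (z s) - g (z s))) * g b)
      + -1 * (\sum_(g in G) (\prod_(s <- r) (s (z s) - g (z s))) * g (z tau * b)).
    rewrite !mulr_sumr -big_split /=; apply: eq_bigr => g _.
    rewrite big_cons rmorphM /=; ring.
  have [Oz _] := zP tau.
  apply: ideal_mulD; first by apply: pEMl; [exact: oi_gal | exact: IHr].
  by apply: pEMl; [apply: oiN; exact: oi1 | apply: IHr; exact: NM].
pose d := \prod_(tau <- enum (G :\ 1%g)) (tau (z tau) - z tau).
have Od_ (tau : gal_of E) : O (tau (z tau) - z tau).
  by have [Oz _] := zP tau; apply: oiB => //; exact: oi_gal.
have Od : O d by apply: oi_prod => tau _.
have nqd : ~ q d.
  move=> /(pideal_prod qP _ _ _ (in1W Od_))[tau]; rewrite mem_enum !inE => /andP[tau1 tauG].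
  by case: (zP tau) => _; exact.
have dN b : N b -> pE (d * b).
  move=> Nb; have := trace_pE (enum (G :\ 1%g)) _ Nb.
  rewrite (bigD1 1%g) ?group1 //= [X in _ + X]big1 ?addr0 => [|g /andP[gG g1]].
    rewrite gal_id; congr (pE (_ * _)); apply: eq_bigr => tau _.
    by rewrite gal_id.
  have gr : g \in enum (G :\ 1%g) by rewrite mem_enum !inE g1.
  by rewrite (big_rem g gr) /= subrr !mul0r.
(* The automorphism [h] need not preserve [q]; the factor [c h], outside [q], compensates for this.
   The product [v] of all of them carries [q] into [N] and is still outside [q]. *)
have /choice[c cP] : forall h : gal_of E, exists c, [/\ O c, ~ q c &
    h \in G -> forall b, q b -> q (h c * h b)].
  move=> h; have [hG|hG] := boolP (h \in G); last first.
    by exists 1; split=> //; [exact: oi1 | exact: pideal1 qP].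
  have [[c [Oc nqc qhc]]|q_h] := gal_decomposition _ hG.
    exists c; split=> // _ b qb; apply: (pidealMr qP) => //.
    by apply: oi_gal; exact: pideal_sub qP _ qb.
  exists 1; split=> [||_ b qb]; [exact: oi1 | exact: pideal1 qP |].
  by rewrite rmorph1 mul1r; exact: q_h.
pose v := \prod_(h <- enum G) c h.
have Oc h : O (c h) by case: (cP h).
have Ov : O v by apply: oi_prod => h _.
have nqv : ~ q v by move=> /(pideal_prod qP _ _ _ (in1W Oc))[h _]; case: (cP h).
have vN b : q b -> N (v * b).
  move=> qb h hG; have hE : h \in enum G by rewrite mem_enum.
  rewrite /v (big_rem h hE) /= !rmorphM /= mulrAC.
  apply: (pidealMr qP); first by apply: oi_gal; apply: oi_prod.
  by case: (cP h) => _ _; exact.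
have nqdv : ~ q (d * v) by case/(pideal_prime qP _ _ Od Ov).
have [w Ow qw] := residue_inv qP _ q_neq0 (oiM E _ _ Od Ov) nqdv.
(* If [pE] were inside the square of [q], then [d * v * x] would be in it, and so would [x], because
   [w] inverts [d * v] modulo [q]. *)
have [x qx] := pideal_sqr_proper qP q_neq0; apply.
have -> : x = w * (d * (v * x)) + (1 - d * v * w) * x by ring.
apply: ideal_mulD; last exact: (ideal_mul_prod _ _ _ _ qw qx).
apply: ideal_mulMl => [a qa|]; first exact: (pidealMl qP _ _ Ow qa).
have /pE_sub : pE (d * (v * x)) by apply: dN; exact: vN.
apply: ideal_mulS => // y [n [a [b [qa Ob ->]]]].
by apply: (pideal_sum qP) => i _; apply: (pidealMr qP).
Qed.

End Ramification.

(** * The septic at 7 *)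

(** [b] is a root of a characteristic polynomial, monic over the integers; the transpose is there
    because eigenvectors are rows. *)
Lemma integral_int_eigen (F : fieldType) n (M : 'M[int]_n) (v : 'I_n -> F) b :
  (exists i, v i != 0) -> (forall i, b * v i = \sum_j (M i j)%:~R * v j) ->
  integralOver (intr : int -> F) b.
Proof.
move=> [i vi] Mv; exists (char_poly M^T); first exact: char_poly_monic.
rewrite map_char_poly -eigenvalue_root_char.
apply/eigenvalueP; exists (\row_j v j).
  apply/rowP=> j; rewrite !mxE Mv; apply: eq_bigr => m _.
  by rewrite !mxE mulrC.
by apply: contraNneq vi => v0;
   have := congr1 (fun u : 'rV_n => u 0 i) v0; rewrite !mxE => ->.
Qed.

(* The lattice spanned by [w ^+ i / l ^+ (i %/ e)], [i < d], is stable under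
   multiplication by [w ^+ e / l]. *)
Lemma integral_slope (F : fieldType) (w : F) (l : int) (e d : nat) (a : nat -> int) :
  l%:~R != 0 :> F -> (0 < e)%N ->
  w ^+ d.+1 = \sum_(i < d.+1) (l ^+ ((d.+1 - i + e.-1) %/ e) * a i)%:~R * w ^+ i ->
  integralOver (intr : int -> F) (w ^+ e / l%:~R).
Proof.
move=> l_neq0 e_gt0 w_eq; pose v k := w ^+ k / l%:~R ^+ (k %/ e).
have span k : exists c : 'I_d.+1 -> int, v k = \sum_j (c j)%:~R * v j.
  elim/ltn_ind: k => k IHk; have [lt_kd|le_dk] := ltnP k d.+1.
    exists (fun j => (j == k :> nat)%:R); rewrite (bigD1 (Ordinal lt_kd)) //= eqxx.
    by rewrite mul1r big1 ?addr0 // => j /negPf; rewrite -val_eqE /= => ->; rewrite mul0r.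
  have lt_m (i : 'I_d.+1) : (k - d.+1 + i < k)%N.
    by rewrite -{2}(subnK le_dk) ltn_add2l.
  have /choice[c cP] : forall i : 'I_d.+1, exists c : 'I_d.+1 -> int,
      v (k - d.+1 + i)%N = \sum_j (c j)%:~R * v j by move=> i; exact: IHk.
  pose f (i : 'I_d.+1) : int := a i * l ^+ ((d.+1 - i + e.-1) %/ e
    + (k - d.+1 + i) %/ e - k %/ e)%N.
  exists (fun j => \sum_(i < d.+1) f i * c i j).
  transitivity (\sum_(i < d.+1) (f i)%:~R * v (k - d.+1 + i)%N); last first.
    under eq_bigr => i _ do rewrite cP mulr_sumr.
    rewrite exchange_big /=; apply: eq_bigr => j _.
    by rewrite rmorph_sum /= mulr_suml; apply: eq_bigr => i _; rewrite intrM mulrA.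
  rewrite /v -{1}(subnK le_dk) exprD w_eq mulr_sumr mulr_suml.
  apply: eq_bigr => i _; rewrite /f.
  (* The floor of [k / e] is at most the ceiling of one summand over [e] plus the floor of the
     other; hence the truncated subtraction in the exponent of [f] is exact. *)
  have le_div : (k %/ e <= (d.+1 - i + e.-1) %/ e + (k - d.+1 + i) %/ e)%N.
    rewrite -ltnS ltn_divLR // mulSn mulnDl.
    have := ltn_ceil (k - d.+1 + i) e_gt0; have := ltn_ceil (d.+1 - i + e.-1) e_gt0.
    rewrite !mulSn; move: (_ * e)%N (_ * e)%N (ltn_ord i) => x y; lia.
  set C := ((_ - i + _) %/ e)%N in le_div *; set B := (_ %/ e)%N in le_div *.
  rewrite !intrM !rmorphXn /= [l%:~R ^+ (_ - _)]expfB_cond ?(negPf l_neq0) ?add0n // !exprD.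
  by field; rewrite ?expf_neq0.
have /choice[c cP] : forall i : 'I_d.+1, exists c : 'I_d.+1 -> int,
    v (i + e)%N = \sum_j (c j)%:~R * v j by move=> i; exact: span.
apply: (@integral_int_eigen _ _ (\matrix_(i, j) c i j) (fun i => v i)) => [|i].
  by exists ord0; rewrite /v expr0 div0n mul1r invr1 oner_neq0.
under eq_bigr do rewrite mxE.
rewrite -cP /v exprD divnDr // divnn e_gt0 addn1 exprSr invfM; ring.
Qed.

Definition septic_coefs (t : int) := [::
  - t ^+ 5 - 23 * t ^+ 4 + 184 * t ^+ 3 - 816 * t ^+ 2 + 1536 * t - 2304;
  7 * (t ^+ 4 - 18 * t ^+ 3 + 68 * t ^+ 2 - 176 * t + 192);
  7 * (3 * t ^+ 2 - 13 * t + 36) * t; 28 * (t ^+ 2 - t + 3);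
  - (7 * (t ^+ 2 - 4 * t + 11)); - (7 * t); 0; 1].

Lemma septicE t : septic t = Poly (septic_coefs t).
Proof.
apply/polyP=> i; rewrite coef_Poly /septic !coefE /septic_coefs.
do 8 (case: i => [|i] /=; first by rewrite ?mulr0 ?mulr1 ?subr0 ?sub0r ?addr0 ?add0r ?mulr0).
by rewrite nth_nil ?mulr0 ?subr0 ?add0r ?addr0.
Qed.

Lemma size_septic t : size (septic t) = 8%N.
Proof. by rewrite septicE (PolyK (c := 0)) //= oner_neq0. Qed.

Lemma septic_monic t : septic t \is monic.
Proof. by rewrite monicE lead_coefE size_septic septicE coef_Poly. Qed.

Section CongruentRoots.

Context {L : splittingFieldType rat} {E : {subfield L}} {q : set L}.
Local Notation O := (ring_of_integers E).
Hypothesis qP : prime_ideal E q.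
Context {t : int} {rs : seq L}.
Hypothesis rs_prod : map_poly intr (septic t) = \prod_(x <- rs) ('X - x%:P).
Hypothesis size_rs : size rs = 7%N.
Hypothesis rs_E : {subset rs <= E}.
Hypothesis rs_cong : forall x y, x \in rs -> y \in rs ->
  exists2 g : gal_of E, g x = y & forall z, O z -> q (g z - z).

Lemma oi_rs x : x \in rs -> O x.
Proof.
move=> x_rs; split; first exact: rs_E.
exists (septic t); first exact: septic_monic.
by rewrite rs_prod root_prod_XsubC.
Qed.

(** Once 7 is cancelled, the coefficients of degrees 5, 4 and 3 put [t], [t ^+ 2 - 4 * t + 11] and
    [4 * (t ^+ 2 - t + 3)] in [q]; reducing the last two modulo [t] leaves the coprime numbers 11
    and 12. *)
Lemma congruent_roots7 : q 7%:R.
Proof.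
apply: contrapT => nq7.
have rs_q x : x \in rs -> q x.
  move=> x_rs; have qsum : q (\sum_(y <- rs) (y - x)).
    rewrite big_seq; apply: (pideal_sum qP) => y y_rs.
    by have [g <- gP] := rs_cong x y x_rs y_rs; apply/gP/oi_rs.
  have sum0 : \sum_(y <- rs) y = 0.
    apply: oppr_inj; rewrite -coefPn_prod_XsubC ?size_rs // -rs_prod coef_map /=.
    by rewrite septicE coef_Poly /= mulr0z oppr0.
  have : q (7%:R * x).
    have := pidealN qP _ qsum; rewrite sumrB sum0 sub0r opprK.
    by rewrite big_const_seq count_predT size_rs iter_addr_0 mulr_natl.
  by case/(pideal_prime qP _ _ (oi_nat E 7) (oi_rs x x_rs)).
have q_coef i : (i < 7)%N -> q ((septic t)`_i)%:~R.
  move=> lt_i7; rewrite -[_%:~R](coef_map intr) rs_prod.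
  rewrite coef_prod_XsubC ?size_rs ?(ltnW lt_i7) //.
  apply: (pidealMl qP); first by apply/oiX/oiN/oi1.
  apply: (pideal_sum qP) => I /eqP cardI.
  have [j jI] : exists j, j \in I by apply/card_gt0P; rewrite cardI subn_gt0.
  rewrite (bigD1 j) //=; apply: (pidealMr qP); last by apply/rs_q/mem_nth; rewrite size_rs.
  by apply: oi_prod => m _; apply/oi_rs/mem_nth; rewrite size_rs.
have cancel7 (m : int) : q (7 * m)%:~R -> q m%:~R.
  by rewrite intrM => /(pideal_prime qP _ _ (oi_nat E 7) (oi_int E m))[].
have qt : q t%:~R.
  apply: cancel7; have := pidealN qP _ (q_coef 5 isT).
  by rewrite -rmorphN /= septicE coef_Poly /=; congr (q _%:~R); ring.
have q11 : q (11 : int)%:~R.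
  have : q (- (t ^+ 2 - 4 * t + 11))%:~R.
    apply: cancel7; have := q_coef 4 isT.
    by rewrite septicE coef_Poly /=; congr (q _%:~R); ring.
  move/(pidealN qP); rewrite -rmorphN opprK => q11.
  have -> : (11 : int)%:~R = (t ^+ 2 - 4 * t + 11)%:~R - (t - 4)%:~R * t%:~R :> L.
    by rewrite -intrM -rmorphB /=; congr (_%:~R); ring.
  by apply: (pidealB qP) => //; apply: (pidealMl qP) => //; exact: oi_int.
have q12 : q (12 : int)%:~R.
  have : q (4 * (t ^+ 2 - t + 3))%:~R.
    apply: cancel7; have := q_coef 3 isT.
    by rewrite septicE coef_Poly /=; congr (q _%:~R); ring.
  move=> q12.
  have -> : (12 : int)%:~R = (4 * (t ^+ 2 - t + 3))%:~R - (4 * (t - 1))%:~R * t%:~R :> L.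
    by rewrite -intrM -rmorphB /=; congr (_%:~R); ring.
  by apply: (pidealB qP) => //; apply: (pidealMl qP) => //; exact: oi_int.
exact: (pideal_coprime qP _ _ q11 q12).
Qed.

End CongruentRoots.

(** The coefficients of degrees 0 to 6 in [X] of a monic septic at [X + n], where the septic has
    lower coefficients [s] and no term of degree 6. The ring is arbitrary so that the same list
    serves over the integers and over polynomials. *)
Definition taylor7 {R : pzRingType} (s : nat -> R) (n : R) := [::
  n ^+ 7 + s 5 * n ^+ 5 + s 4 * n ^+ 4 + s 3 * n ^+ 3 + s 2 * n ^+ 2 + s 1 * n + s 0;
  7 * n ^+ 6 + 5 * s 5 * n ^+ 4 + 4 * s 4 * n ^+ 3 + 3 * s 3 * n ^+ 2 + 2 * s 2 * n + s 1;
  21 * n ^+ 5 + 10 * s 5 * n ^+ 3 + 6 * s 4 * n ^+ 2 + 3 * s 3 * n + s 2;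
  35 * n ^+ 4 + 10 * s 5 * n ^+ 2 + 4 * s 4 * n + s 3;
  35 * n ^+ 3 + 5 * s 5 * n + s 4;
  21 * n ^+ 2 + s 5;
  7 * n].

Lemma taylor7P (R : comPzRingType) (s : nat -> R) (n X : R) :
  (X + n) ^+ 7 + \sum_(i < 6) s i * (X + n) ^+ i =
  X ^+ 7 + \sum_(i < 7) (taylor7 s n)`_i * X ^+ i.
Proof. by rewrite !big_ord_recl !big_ord0 /bump /=; ring. Qed.

Lemma taylor7_morph (R S : comPzRingType) (f : {rmorphism R -> S}) (s : nat -> R) n i :
  f (taylor7 s n)`_i = (taylor7 (f \o s) (f n))`_i.
Proof.
do 7 (case: i => [|i]; first by rewrite /=; ring).
by rewrite /= ?nth_nil rmorph0.
Qed.

Lemma septic_taylor t n : septic t \Po ('X + n%:P) =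
  'X^7 + \sum_(i < 7) ((taylor7 (nth 0 (septic_coefs t)) n)`_i)%:P * 'X^i.
Proof.
under eq_bigr do rewrite taylor7_morph; rewrite -taylor7P /=.
rewrite [in LHS](_ : septic t = 'X^7 + \sum_(i < 6) ((septic_coefs t)`_i)%:P * 'X^i).
  rewrite rmorphD rmorphXn rmorph_sum /= comp_polyX; congr (_ + _).
  by apply: eq_bigr => i _; rewrite rmorphM rmorphXn /= comp_polyC comp_polyX.
apply/polyP => i; rewrite septicE coefD coefXn coef_sum coef_Poly.
under eq_bigr do rewrite coefCM coefXn.
rewrite !big_ord_recl big_ord0 /bump.
do 8 (case: i => [|i] /=; first by rewrite ?mulr0 ?mulr1 ?addr0 ?add0r ?mulr0 ?addr0 ?add0r).
by rewrite ?nth_nil !mulr0 !addr0.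
Qed.

(* The 7-adic Newton polygon of [septic t] at [n] has six roots of valuation [1 / e]
   and one of larger valuation. *)
Definition adic_slopes (t : int) := exists (n : int) (e : nat) (a : nat -> int),
  [/\ e \in [:: 2; 3; 6]%N,
      forall i, (i < 7)%N -> (taylor7 (nth 0 (septic_coefs t)) n)`_i =
        7 ^+ ((7 - i + e.-1) %/ e) * a i
    & coprimez 7 (a 1)].

(** How the data below are found: the inner coefficients of the septic are multiples of 7, so modulo
    7 it is the seventh power of [X - n] with [n] congruent to minus the constant term; [n] is taken
    between -3 and 3. The list [a] holds the Taylor coefficients at [n] divided by the required
    powers of 7, and [c] is the residue of [a 1] modulo 7. *)
Lemma adic_slopesI (n : int) (e : nat) (c r : int) (a : nat -> int) t :
  e \in [:: 2; 3; 6]%N -> coprimez 7 c -> a 1 = r * 7 + c ->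
  (forall i, (i < 7)%N -> (taylor7 (nth 0 (septic_coefs t)) n)`_i =
        7 ^+ ((7 - i + e.-1) %/ e) * a i) -> adic_slopes t.
Proof.
move=> e_in c7 a1 aE; exists n, e, a; split=> //.
by rewrite /coprimez a1 gcdzMDl.
Qed.

Ltac slope_coef tE :=
  rewrite /= ?tE;
  match goal with |- context [divn ?x ?y] =>
    let v := eval vm_compute in (divn x y) in change (divn x y) with v
  end; ring.

Lemma eqz_mod_eq (m a b : int) : (a = b %[mod m])%Z -> exists k, a = b + m * k.
Proof.
move=> /eqP; rewrite eqz_mod_dvd => /dvdzP[k abE]; exists k.
by rewrite mulrC -abE addrC subrK.
Qed.

(** With [e = 3] the constant coefficient must be divisible by [7 ^ 3]. A congruence modulo 7 is
    enough, because after substituting [3 + 7 * k] for [t] the divisibility holds identically in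
    [k]. *)
Lemma adic_slopes_3_7 (t : int) : (t = 3 %[mod 7])%Z -> adic_slopes t.
Proof.
case/eqz_mod_eq => k tE.
apply: (adic_slopesI 1 3 4
  (1 - 3 * k - 4 * k ^+ 2 + 49 * k ^+ 4)
  (nth 0 [::
    - 7 - 39 * k - 119 * k ^+ 2 - 203 * k ^+ 3 - 217 * k ^+ 4 - 49 * k ^+ 5;
    11 - 21 * k - 28 * k ^+ 2 + 343 * k ^+ 4;
    15 + 77 * k + 140 * k ^+ 2 + 147 * k ^+ 3;
    - 3 + 2 * k;
    - 18 - 49 * k - 49 * k ^+ 2;
    - 7 * k;
    1])) => //.
- by rewrite /= ?tE; ring.
- do 7 (case=> [_|]; first by slope_coef tE).
  by [].
Qed.

(** A multiple of [t + 17] in a Taylor coefficient is rewritten with [49 * k], and what remains has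
    coefficients divisible by the required power of 7. For [e = 6] the constant coefficient needs
    [7 ^ 2], hence the modulus 49. The tables for 5, 7, 13 and 743 arise in the same way. *)
Lemma adic_slopes_m17_49 (t : int) : (t = -17 %[mod 49])%Z -> adic_slopes t.
Proof.
case/eqz_mod_eq => k tE.
apply: (adic_slopesI (-2) 6 5
  ((k * (- 21 - 14 * t + 14 * t ^+ 2 + 7 * t ^+ 3) + (115 - 77 * t + 24 * t ^+ 2
    - 7 * t ^+ 3)) - 1)
  (nth 0 [::
    k * (- 1 + 13 * t - 22 * t ^+ 2 - 20 * t ^+ 3 - t ^+ 4) - 143 + 116 * t
      - 43 * t ^+ 2 + 18 * t ^+ 3;
    7 * (k * (- 21 - 14 * t + 14 * t ^+ 2 + 7 * t ^+ 3) + 115 - 77 * t + 24 * t ^+ 2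
      - 7 * t ^+ 3) - 2;
    7 * (k * (- 14 + 21 * t ^+ 2) - 57 + 34 * t - 16 * t ^+ 2) + 1;
    7 * (k * (- 14 * t) + 26 - 6 * t + 2 * t ^+ 2) - 2;
    7 * (k * (21 - 7 * t) - 15 + 4 * t) + 3;
    7 * (k * (- 7) + 4) + 1;
    -2])) => //.
- by rewrite /= ?tE; ring.
- do 7 (case=> [_|]; first by slope_coef tE).
  by [].
Qed.

(** Here [e = 2] and the constant coefficient must be divisible by [7 ^ 4]; as a polynomial in [k]
    it is, although [t] is known only modulo [7 ^ 2]. *)
Lemma adic_slopes_m5_49 (t : int) : (t = -5 %[mod 49])%Z -> adic_slopes t.
Proof.
case/eqz_mod_eq => k tE.
apply: (adic_slopesI 3 2 6
  (1 - 63 * k + 980 * k ^+ 2 - 20 * 7 ^+ 3 * k ^+ 3 + 7 ^+ 5 * k ^+ 4)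
  (nth 0 [::
    1 - 49 * k + 1007 * k ^+ 2 - 215 * 7 ^+ 2 * k ^+ 3 + 23 * 7 ^+ 4 * k ^+ 4
      - 7 ^+ 6 * k ^+ 5;
    13 - 441 * k + 20 * 7 ^+ 3 * k ^+ 2 - 20 * 7 ^+ 4 * k ^+ 3 + 7 ^+ 6 * k ^+ 4;
    - 13 + 481 * k - 76 * 7 ^+ 2 * k ^+ 2 + 3 * 7 ^+ 4 * k ^+ 3;
    45 + 238 * k - 8 * 7 ^+ 3 * k ^+ 2;
    22 - 7 * k - 343 * k ^+ 2;
    32 - 49 * k;
    3])) => //.
- by rewrite /= ?tE; ring.
- do 7 (case=> [_|]; first by slope_coef tE).
  by [].
Qed.

Lemma adic_slopes_5_49 (t : int) : (t = 5 %[mod 49])%Z -> adic_slopes t.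
Proof.
case/eqz_mod_eq => k tE.
apply: (adic_slopesI (-3) 6 6
  ((k * (- 7 - 21 * t - 21 * t ^+ 2 + 7 * t ^+ 3) + (347 - 193 * t + 50 * t ^+ 2
    - 4 * t ^+ 3)) - 1)
  (nth 0 [::
    k * (5 + 6 * t + 16 * t ^+ 2 - t ^+ 4) - 347 + 250 * t - 88 * t ^+ 2
      + 15 * t ^+ 3 - t ^+ 4;
    7 * (k * (- 7 - 21 * t - 21 * t ^+ 2 + 7 * t ^+ 3) + 347 - 193 * t + 50 * t ^+ 2
      - 4 * t ^+ 3) - 1;
    7 * (k * (- 7 + 21 * t + 21 * t ^+ 2) - 205 + 82 * t - 13 * t ^+ 2) - 1;
    7 * (k * (7 + 14 * t) + 79 - 19 * t + 2 * t ^+ 2) + 1;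
    7 * (k * (- 7 * t) - 21 + 2 * t) + 1;
    7 * (k * (- 7) + 3) + 1;
    -3])) => //.
- by rewrite /= ?tE; ring.
- do 7 (case=> [_|]; first by slope_coef tE).
  by [].
Qed.

Lemma adic_slopes_7_49 (t : int) : (t = 7 %[mod 49])%Z -> adic_slopes t.
Proof.
case/eqz_mod_eq => k tE.
apply: (adic_slopesI 1 6 3
  (k * (7 * t + 14 * t ^+ 2 + 7 * t ^+ 3) + (26 - 14 * t + 9 * t ^+ 2 - t ^+ 3))
  (nth 0 [::
    k * (- 18 - 4 * t + 16 * t ^+ 2 - 23 * t ^+ 3 - t ^+ 4) - 22 + 11 * t
      - 6 * t ^+ 2 - 2 * t ^+ 3;
    7 * (k * (7 * t + 14 * t ^+ 2 + 7 * t ^+ 3) + 26 - 14 * t + 9 * t ^+ 2 - t ^+ 3)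
      + 3;
    7 * (k * (21 + 21 * t ^+ 2) - 1 + 5 * t + 2 * t ^+ 2) + 1;
    7 * (k * 14 - 2) + 1;
    7 * (k * (- 7 - 7 * t) - 2 - t) + 1;
    7 * (k * (- 7) - 1) + 3;
    1])) => //.
- by rewrite /= ?tE; ring.
- do 7 (case=> [_|]; first by slope_coef tE).
  by [].
Qed.

Lemma adic_slopes_13_49 (t : int) : (t = 13 %[mod 49])%Z -> adic_slopes t.
Proof.
case/eqz_mod_eq => k tE.
apply: (adic_slopesI (-3) 6 4
  ((k * (- 14 * t ^+ 2 + 7 * t ^+ 3) + (348 - 191 * t + 48 * t ^+ 2 - 3 * t ^+ 3)) - 1)
  (nth 0 [::
    k * (17 + 7 * t + 10 * t ^+ 2 - 8 * t ^+ 3 - t ^+ 4) - 343 + 251 * t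
      - 87 * t ^+ 2 + 13 * t ^+ 3 - t ^+ 4;
    7 * (k * (- 14 * t ^+ 2 + 7 * t ^+ 3) + 348 - 191 * t + 48 * t ^+ 2 - 3 * t ^+ 3)
      - 3;
    7 * (k * (- 7 - 7 * t + 21 * t ^+ 2) - 206 + 78 * t - 9 * t ^+ 2) - 2;
    7 * (k * (21 + 14 * t) + 84 - 17 * t + 2 * t ^+ 2);
    7 * (k * (- 7 - 7 * t) - 23 + t) + 2;
    7 * (k * (- 7) + 2);
    -3])) => //.
- by rewrite /= ?tE; ring.
- do 7 (case=> [_|]; first by slope_coef tE).
  by [].
Qed.

(** For [e = 2] the constant coefficient needs [7 ^ 4], which is the modulus. *)
Lemma adic_slopes_743_2401 (t : int) : (t = 743 %[mod 2401])%Z -> adic_slopes t.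
Proof.
case/eqz_mod_eq => k tE.
apply: (adic_slopesI 3 2 1
  (k * (336 + 1064 * t + 399 * t ^+ 2 + 7 * t ^+ 3) + (104 + 329 * t + 123 * t ^+ 2
    + 2 * t ^+ 3))
  (nth 0 [::
    k * (362 - 943 * t + 1091 * t ^+ 2 - 745 * t ^+ 3 - t ^+ 4) + 112 - 292 * t
      + 338 * t ^+ 2 - 231 * t ^+ 3;
    7 * (k * (336 + 1064 * t + 399 * t ^+ 2 + 7 * t ^+ 3) + 104 + 329 * t
      + 123 * t ^+ 2 + 2 * t ^+ 3) + 1;
    7 * (k * (259 + 980 * t + 21 * t ^+ 2) + 81 + 303 * t + 6 * t ^+ 2) - 1;
    49 * (k * (- 1113 - 56 * t) - 344 - 17 * t) + 20;
    49 * (k * (- 476 - 7 * t) - 147 - 2 * t) + 3;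
    343 * (k * (- 7) - 2) - 30;
    3])) => //.
- by rewrite /= ?tE; ring.
- do 7 (case=> [_|]; first by slope_coef tE).
  by [].
Qed.

Section RootsAtSeven.

Context {L : splittingFieldType rat} {E : {subfield L}} {q : set L}.
Local Notation O := (ring_of_integers E).
Hypothesis qP : prime_ideal E q.
Context {t : int} {rs : seq L}.
Hypothesis rs_prod : map_poly intr (septic t) = \prod_(x <- rs) ('X - x%:P).
Hypothesis size_rs : size rs = 7%N.
Hypothesis rs_E : {subset rs <= E}.
Hypothesis rs_cong : forall x y, x \in rs -> y \in rs ->
  exists2 g : gal_of E, g x = y & forall z, O z -> q (g z - z).

(** Write [w] for a root minus [n]. All [b w = w ^+ e / 7] are integral, and the extra slope of one
    root puts their product in [q]. Congruence then puts every [b w] in [q], and with them [a 1],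
    which is the sixth elementary symmetric function of the [w] divided by [7 ^ (6 / e)]. But [a 1]
    is prime to 7. *)
Lemma congruent_roots_slopes : ~ adic_slopes t.
Proof.
case=> n [e [a [e_in aE a1_7]]].
have q7 : q 7%:R := congruent_roots7 qP rs_prod size_rs rs_E rs_cong.
have e_cases : [\/ e = 2, e = 3 | e = 6].
  by move: e_in; rewrite !inE => /or3P[]/eqP; constructor.
have e_gt0 : (0 < e)%N by case: e_cases => ->.
have e_dvd : (e * ((6 + e.-1) %/ e) = 6)%N by case: e_cases => ->.
have e_big : (7 < e * ((7 + e.-1) %/ e))%N by case: e_cases => ->.
have neq7 : 7%:R != 0 :> L by rewrite (intr_ext_eq0 L 7).
pose ws := [seq x - n%:~R | x <- rs].
have size_ws : size ws = 7%N by rewrite size_map.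
have ws_prod : \prod_(w <- ws) ('X - w%:P) =
    'X^7 + \sum_(i < 7) ((7 ^+ ((7 - i + e.-1) %/ e) * a i)%:~R)%:P * 'X^i.
  rewrite /ws big_map.
  transitivity (map_poly (intr : int -> L) (septic t \Po ('X + n%:P))).
    rewrite map_comp_poly /= rs_prod rmorphD /= map_polyX map_polyC /=.
    rewrite rmorph_prod; apply: eq_bigr => x _ /=.
    by rewrite comp_polyB comp_polyX comp_polyC polyCB; ring.
  rewrite septic_taylor rmorphD /= map_polyXn rmorph_sum; congr (_ + _).
  apply: eq_bigr => i _ /=.
  by rewrite rmorphM /= map_polyC map_polyXn /= aE.
have ws_coef i : (i < 7)%N -> (\prod_(w <- ws) ('X - w%:P))`_i =
    (7 ^+ ((7 - i + e.-1) %/ e) * a i)%:~R.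
  move=> lt_i; rewrite ws_prod coefD coefXn (ltn_eqF lt_i) add0r coef_sum.
  rewrite (bigD1 (Ordinal lt_i)) //= coefCM coefXn eqxx mulr1.
  rewrite big1 ?addr0 // => j /negPf; rewrite -val_eqE /= => ne_j.
  by rewrite coefCM coefXn eq_sym ne_j mulr0.
have O_ws w : w \in ws -> O w.
  case/mapP => x x_rs ->; apply: oiB; last exact: oi_int.
  exact: (oi_rs rs_prod rs_E).
pose b (w : L) := w ^+ e / 7%:R.
have O_b w : w \in ws -> O (b w).
  move=> w_ws; split.
    by apply: rpred_div; [apply: rpredX; case: (O_ws w w_ws) | apply: rpred_nat].
  rewrite -[integralOver _ _]/(integralOver _ (w ^+ e / (7 : int)%:~R)).
  apply: (@integral_slope _ w 7 e 6 (fun i => - a i)) => //.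
  have /rootP : root (\prod_(w <- ws) ('X - w%:P)) w by rewrite root_prod_XsubC.
  rewrite ws_prod hornerD hornerXn horner_sum => /eqP; rewrite addr_eq0 => /eqP->.
  rewrite -sumrN; apply: eq_bigr => i _.
  by rewrite hornerM hornerC hornerXn mulrN rmorphN mulNr.
(* The product is, up to sign, [(7 ^ c * a 0) ^ e / 7 ^ 7] with [c] the ceiling of [7 / e]; since
   [e] does not divide 7, [e * c] is at least 8 and a factor 7 is left. *)
have prod_b : q (\prod_(w <- ws) b w).
  have := ws_coef 0 isT; rewrite coef0_prod_XsubC size_ws => w0.
  have -> : \prod_(w <- ws) b w = (\prod_(w <- ws) w) ^+ e / 7%:R ^+ 7.
    by rewrite big_split /= prodrXl big_const_seq count_predT size_ws iter_mulr_1 exprVn.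
  have wsE : \prod_(w <- ws) w = - (7 ^+ ((7 + e.-1) %/ e) * a 0)%:~R.
    by rewrite -w0 -signr_odd mulN1r opprK.
  have -> : (\prod_(w <- ws) w) ^+ e / 7%:R ^+ 7 =
      ((- 1) ^+ e * 7 ^+ (e * ((7 + e.-1) %/ e) - 8) * a 0 ^+ e)%:~R * 7%:R.
    rewrite wsE -(mulN1r (_ %:~R)) intrM !exprMn rmorphXn /= -exprM mulnC.
    rewrite -{1}(subnKC e_big) exprD !intrM !rmorphXn /= rmorphN1.
    have -> : (7 : int)%:~R = 7%:R :> L by [].
    suff cancel (s x y z : L) : s != 0 ->
      x * (s ^+ 8 * y * z) / s ^+ 7 = x * y * z * s by exact: cancel.
    by move=> s_neq0; field.
  by apply: (pidealMl qP) => //; exact: oi_int.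
(* One [b w] is in [q] by primality. The congruence of the automorphisms holds on all integers, so
   it applies to [b w] and not only to the roots. *)
have q_b w : w \in ws -> q (b w).
  have [_ /mapP[x x_rs ->] qx] := pideal_prod qP _ _ _ O_b prod_b.
  case/mapP=> y y_rs ->; have [g gx gP] := rs_cong x y x_rs y_rs.
  have -> : b (y - n%:~R) = g (b (x - n%:~R)).
    by rewrite /b rmorphM fmorphV rmorphXn rmorphB /= gx rmorph_int rmorph_nat.
  rewrite -[g _](subrK (b (x - n%:~R))); apply: (pidealD qP) => //.
  by apply/gP/O_b/mapP; exists x.
apply: (pideal_coprime qP 7 (a 1) q7 _ a1_7).
have := ws_coef 1 isT; rewrite coef_prod_XsubC; last by rewrite size_ws.
have -> : (size ws - 1 = 6)%N by rewrite size_ws.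
rewrite -signr_odd mul1r intrM rmorphXn /= => sumE.
set c := (_ %/ e)%N in e_dvd sumE.
have -> : (a 1)%:~R = \sum_(I in {set 'I_(size ws)} | #|I| == 6%N)
    (\prod_(i in I) ws`_i / 7%:R ^+ c).
  by rewrite -mulr_suml sumE mulrAC mulfV ?mul1r ?expf_neq0.
apply: (pideal_sum qP) => I /eqP cardI.
have memI (i : 'I_(size ws)) : ws`_i \in ws by exact/mem_nth/ltn_ord.
(* As [e * c = 6] is the size of [I], each scaled product of six [w] is an [e]-th root of an element
   of [q]; hence it is integral and itself in [q]. *)
have gammaE : (\prod_(i in I) ws`_i / 7%:R ^+ c) ^+ e = \prod_(i in I) b ws`_i.
  rewrite big_split /= prodrXl prodr_const cardI exprMn exprVn -exprM mulnC e_dvd.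
  by rewrite exprVn.
have q_gamma : q (\prod_(i in I) b ws`_i).
  have [j jI] : exists j, j \in I by apply/card_gt0P; rewrite cardI.
  rewrite (bigD1 j) //=; apply: (pidealMr qP); last exact: q_b.
  by apply: oi_prod => i _; exact: O_b.
apply: (pideal_exp qP _ e); rewrite ?gammaE //; apply: (oi_root_exp _ _ e) => //.
  apply: rpred_div; last by apply: rpredX; exact: rpred_nat.
  by apply: rpred_prod => i _; have [] := O_ws _ (memI i).
by rewrite gammaE; exact: pideal_sub q_gamma.
Qed.

End RootsAtSeven.

(** * The cyclic structure of the roots of the septic *)

Section CyclicVector.

Context {F : fieldType} {n : nat} {p : {poly F}} {M : 'M[F]_n.+1} {e : 'rV[F]_n.+1}.
Hypothesis p_irr : irreducible_poly p.
Hypothesis size_p : size p = n.+2.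
Hypothesis e_neq0 : e != 0.
Hypothesis pM0 : e *m horner_mx M p = 0.

(** If [p] did not divide [g], the two would be coprime and a Bezout relation would kill [e]. So [e]
    generates a copy of [F[X]/(p)] under [M]. *)
Lemma cyclic_annihilator g : (e *m horner_mx M g == 0) = (p %| g).
Proof.
apply/eqP/idP=> [gM0|/dvdpP[h ->]]; last first.
  by rewrite mulrC rmorphM mulmxA pM0 mul0mx.
apply: contraNT e_neq0; rewrite -(irreducible_poly_coprime _ p_irr).
case/Bezout_eq1_coprimepP => -[u v] /= uv1.
have -> : e = e *m horner_mx M (p * u + g * v).
  by rewrite (mulrC p) (mulrC g) uv1 rmorph1 mulmx1.
by rewrite rmorphD !rmorphM mulmxDr !mulmxA pM0 gM0 !mul0mx addr0.
Qed.

(** The rows [e M ^ i] below the degree of [p] are independent by the previous lemma, and there are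
    as many as the dimension. *)
Lemma cyclic_span v : exists g, v = e *m horner_mx M g.
Proof.
pose W := \matrix_(i < n.+1) (e *m M ^+ i).
have WE u : u *m W = e *m horner_mx M (rVpoly u).
  rewrite mulmx_sum_row {2}[u]row_sum_delta linear_sum /= rmorph_sum mulmx_sumr.
  apply: eq_bigr => i _.
  by rewrite linearZ /= rVpoly_delta horner_mxZ rmorphXn /= horner_mx_X -scalemxAr rowK.
have W_unit : W \in unitmx.
  rewrite -row_free_unit -kermx_eq0; apply/rowV0P => u /sub_kermxP.
  rewrite WE => /eqP; rewrite cyclic_annihilator => p_dvd.
  have : rVpoly u = 0.
    have [//|u_neq0] := eqVneq (rVpoly u) 0.
    by have := leq_trans (dvdp_leq u_neq0 p_dvd) (size_poly _ _); rewrite size_p ltnn.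
  by move/(congr1 (poly_rV (d := n.+1))); rewrite rVpolyK linear0.
by exists (rVpoly (v *m invmx W)); rewrite -WE mulmxKV.
Qed.

(** A matrix commuting with [M] is determined by its effect on the cyclic vector. *)
Lemma cyclic_commutant N : comm_mx M N -> exists g, N = horner_mx M g.
Proof.
move=> MN; have [g gE] := cyclic_span (e *m N); exists g.
apply/row_matrixP => i; rewrite !rowE; have [h ->] := cyclic_span 'e_i.
rewrite -!mulmxA (comm_horner_mx h MN) [LHS]mulmxA gE -mulmxA.
by congr (_ *m _); exact: comm_horner_mx2.
Qed.

(** In [F[X]/(p)], [N i] is multiplication by the class of some [g i]; since [p] of [N i] kills [e],
    [p] divides [p] composed with [g i], so [g i] sends a root to a root. Distinct rows [e N i] give
    distinct classes, hence distinct values at [x]. *)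
Lemma conjugate_roots (L : fieldType) (f : {rmorphism F -> L}) (x : L) m
    (N : 'I_m -> 'M[F]_n.+1) :
  root (map_poly f p) x -> (forall i, GRing.comm M (N i)) ->
  (forall i, e *m horner_mx (N i) p = 0) -> injective (fun i => e *m N i) ->
  exists2 g : 'I_m -> {poly F}, forall i, root (map_poly f p) (map_poly f (g i)).[x]
    & injective (fun i => (map_poly f (g i)).[x]).
Proof.
move=> px MN pN eN_inj.
have /choice[g gE] : forall i, exists g, e *m N i = e *m horner_mx M g.
  by move=> i; exact: cyclic_span.
have root0 h : (map_poly f h).[x] = 0 -> p %| h.
  move=> hx; apply: contraTT (oner_neq0 L); rewrite -(irreducible_poly_coprime _ p_irr).
  case/Bezout_eq1_coprimepP => -[u v] /= /(congr1 (fun h => (map_poly f h).[x])).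
  rewrite rmorph1 hornerC rmorphD !rmorphM hornerD !hornerM hx (rootP px) !mulr0 addr0.
  by move=> <-; rewrite eqxx.
exists g => [i|i j gij].
  have eN h : e *m horner_mx (N i) h = e *m horner_mx M (h \Po g i).
    elim/poly_ind: h => [|h c IHh]; first by rewrite comp_poly0 !rmorph0.
    rewrite comp_polyD comp_polyM comp_polyX comp_polyC !rmorphD !rmorphM /=.
    rewrite !horner_mx_C horner_mx_X !mulmxDr; congr (_ + _).
    rewrite [LHS]mulmxA IHh -mulmxA (comm_horner_mx (h \Po g i) (MN i)) mulmxA gE.
    by rewrite -mulmxA -[_ *m horner_mx M (h \Po g i)]rmorphM mulrC rmorphM.
  have /dvdpP[h hE] : p %| p \Po g i by rewrite -cyclic_annihilator -eN pN.
  by rewrite /root -horner_comp -map_comp_poly hE rmorphM hornerM (rootP px) mulr0.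
apply: eN_inj; rewrite !gE; apply/eqP; rewrite -subr_eq0 -mulmxBr -rmorphB.
by rewrite cyclic_annihilator; apply: root0; rewrite rmorphB hornerD hornerN gij subrr.
Qed.

End CyclicVector.

(* Computable arithmetic in [K] with coefficients in [Z[t]] *)
Delimit Scope Z_scope with BinZ.

(* Elements of Z[t] are lists of coefficients, constant term first; a [cub] is the
   triple of coordinates on [1, y, z] and a [kel] the pair of coordinates on [1, s].
   The constants in [cmul] are those of [y ^+ 2], [y * z] and [z ^+ 2], where [y] and
   [z] are the roots of the cubic attached to the steps 1 and 2 of the cyclic order. *)
Definition tpoly := seq Z.

Fixpoint tadd (a b : tpoly) : tpoly :=
  match a, b with
  | [::], _ => b
  | _, [::] => a
  | x :: a', y :: b' => Z.add x y :: tadd a' b'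
  end.

Definition tscale (c : Z) (a : tpoly) : tpoly := map (Z.mul c) a.

Fixpoint tmul (a b : tpoly) : tpoly :=
  if a is x :: a' then tadd (tscale x b) (Z0 :: tmul a' b) else [::].

Definition tzero (a : tpoly) := all (Z.eqb Z0) a.

Definition cub : Type := tpoly * tpoly * tpoly.

Definition cadd (a b : cub) : cub :=
  let: (a0, a1, a2) := a in let: (b0, b1, b2) := b in
  (tadd a0 b0, tadd a1 b1, tadd a2 b2).

Definition cscale (c : tpoly) (a : cub) : cub :=
  let: (a0, a1, a2) := a in (tmul c a0, tmul c a1, tmul c a2).

Definition cmul (a b : cub) : cub :=
  let: (a0, a1, a2) := a in let: (b0, b1, b2) := b in
  cadd (tmul a0 b0, tadd (tmul a0 b1) (tmul a1 b0), tadd (tmul a0 b2) (tmul a2 b0))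
    (cadd (cscale (tmul a1 b1) ([:: 14; -5; 2], [:: -1], [:: 2; -1])%BinZ)
      (cadd (cscale (tadd (tmul a1 b2) (tmul a2 b1))
               ([:: -7; 1; -1], [:: 3], [:: 1; 1])%BinZ)
            (cscale (tmul a2 b2) ([:: 14; -3; 1], [:: -2; 1], [:: -3; 1])%BinZ))).

Definition czero (a : cub) := let: (a0, a1, a2) := a in [&& tzero a0, tzero a1 & tzero a2].

Definition kel : Type := cub * cub.

Definition kadd (a b : kel) : kel := (cadd a.1 b.1, cadd a.2 b.2).
Definition kscale (c : tpoly) (a : kel) : kel := (cscale c a.1, cscale c a.2).
(** The constant is the value [- 7 * (t - 1) ^+ 2 - 28] of [s ^+ 2], expanded. *)
Definition kmul (a b : kel) : kel :=
  (cadd (cmul a.1 b.1) (cscale [:: -35; 14; -7]%BinZ (cmul a.2 b.2)),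
   cadd (cmul a.1 b.2) (cmul a.2 b.1)).
Definition kzero (a : kel) := czero a.1 && czero a.2.

Definition kconst (c : tpoly) : kel := ((c, [::], [::]), ([::], [::], [::])).
Definition k0 : kel := kconst [::].
Definition ksub (a b : kel) : kel := kadd a (kscale [:: -1]%BinZ b).

Section Evaluation.

Context {F : comNzRingType} (t : int) (y z s : F).

(** Binary recursion lets simplification turn a numeral into a term in 1 and 2 that [ring] can
    read. *)
Fixpoint posinj (p : positive) : F :=
  match p with
  | xH => 1 | xO p' => 2 * posinj p' | xI p' => 1 + 2 * posinj p'
  end.

Definition zinj (c : Z) : F :=
  match c with Z0 => 0 | Zpos p => posinj p | Zneg p => - posinj p end.

Definition teval (a : tpoly) : F := foldr (fun c r => zinj c + t%:~R * r) 0 a.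
Definition ceval (a : cub) : F :=
  let: (a0, a1, a2) := a in teval a0 + teval a1 * y + teval a2 * z.
Definition keval (a : kel) : F := ceval a.1 + ceval a.2 * s.

Lemma posinjE p : posinj p = (Pos.to_nat p)%:R.
Proof.
elim: p => [p IHp|p IHp|] //=; rewrite IHp.
  by rewrite Pos2Nat.inj_xI multE -[RHS]natr1 natrM addrC.
by rewrite Pos2Nat.inj_xO multE natrM.
Qed.

Lemma zinjE c : zinj c = (int_of_Z c)%:~R.
Proof.
case: c => [|p|p] //=; first exact: posinjE.
by rewrite posinjE NegzE prednK ?rmorphN //; apply/ssrnat.ltP/Pos2Nat.is_pos.
Qed.

Lemma zinjD a b : zinj (Z.add a b) = zinj a + zinj b.
Proof. by rewrite !zinjE -intrD -rmorphD. Qed.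

Lemma zinjM a b : zinj (Z.mul a b) = zinj a * zinj b.
Proof. by rewrite !zinjE -intrM -rmorphM. Qed.

Lemma tevalD a b : teval (tadd a b) = teval a + teval b.
Proof.
elim: a b => [|x a IHa] [|x' b] /=; rewrite ?add0r ?addr0 //.
by rewrite zinjD IHa; ring.
Qed.

Lemma tevalZ c a : teval (tscale c a) = zinj c * teval a.
Proof.
by elim: a => [|x a IHa] /=; rewrite ?mulr0 // zinjM IHa; ring.
Qed.

Lemma tevalM a b : teval (tmul a b) = teval a * teval b.
Proof.
elim: a => [|x a IHa] /=; first by rewrite mul0r.
by rewrite tevalD tevalZ /= IHa; ring.
Qed.

Lemma teval0 a : tzero a -> teval a = 0.
Proof.
elim: a => //= -[] //= a IHa /IHa->.
by rewrite mulr0 addr0.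
Qed.

Lemma cevalD a b : ceval (cadd a b) = ceval a + ceval b.
Proof. by case: a => [[a0 a1] a2]; case: b => [[b0 b1] b2]; rewrite /= !tevalD; ring. Qed.

Lemma cevalZ c a : ceval (cscale c a) = teval c * ceval a.
Proof. by case: a => [[a0 a1] a2]; rewrite /= !tevalM; ring. Qed.

Lemma ceval0 a : czero a -> ceval a = 0.
Proof.
by case: a => [[a0 a1] a2] /= /and3P[/teval0-> /teval0-> /teval0->]; rewrite !mul0r !addr0.
Qed.

Lemma kevalD a b : keval (kadd a b) = keval a + keval b.
Proof. by rewrite /keval !cevalD; ring. Qed.

Lemma kevalZ c a : keval (kscale c a) = teval c * keval a.
Proof. by rewrite /keval !cevalZ; ring. Qed.

Lemma keval0 a : kzero a -> keval a = 0.
Proof. by case/andP=> /ceval0 a1 /ceval0 a2; rewrite /keval a1 a2 mul0r addr0. Qed.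

Lemma kevalC c : keval (kconst c) = teval c.
Proof. by rewrite /keval /=; ring. Qed.

Lemma kevalB a b : keval (ksub a b) = keval a - keval b.
Proof. by rewrite kevalD kevalZ /=; ring. Qed.

Hypothesis yy : y ^+ 2 = (14 - 5 * t + 2 * t ^+ 2)%:~R - y + (2 - t)%:~R * z.
Hypothesis yz : y * z = (- 7 + t - t ^+ 2)%:~R + 3 * y + (1 + t)%:~R * z.
Hypothesis zz :
  z ^+ 2 = (14 - 3 * t + t ^+ 2)%:~R + (t - 2)%:~R * y + (t - 3)%:~R * z.
Hypothesis ss : s ^+ 2 = (- 7 * (t - 1) ^+ 2 - 28)%:~R.

Lemma cevalM a b : ceval (cmul a b) = ceval a * ceval b.
Proof.
case: a => [[a0 a1] a2]; case: b => [[b0 b1] b2].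
rewrite /cmul !cevalD !cevalZ /ceval !(tevalD, tevalM).
have -> : (teval a0 + teval a1 * y + teval a2 * z) * (teval b0 + teval b1 * y + teval b2 * z)
  = teval a0 * teval b0 + (teval a0 * teval b1 + teval a1 * teval b0) * y
    + (teval a0 * teval b2 + teval a2 * teval b0) * z
    + teval a1 * teval b1 * y ^+ 2 + (teval a1 * teval b2 + teval a2 * teval b1) * (y * z)
    + teval a2 * teval b2 * z ^+ 2 by ring.
rewrite yy yz zz /=; ring.
Qed.

Lemma kevalM a b : keval (kmul a b) = keval a * keval b.
Proof.
rewrite /keval /= !cevalD cevalZ !cevalM.
have -> : (ceval a.1 + ceval a.2 * s) * (ceval b.1 + ceval b.2 * s) =
  ceval a.1 * ceval b.1 + ceval a.2 * ceval b.2 * s ^+ 2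
  + (ceval a.1 * ceval b.2 + ceval a.2 * ceval b.1) * s by ring.
by rewrite ss /=; ring.
Qed.

End Evaluation.

(** * Matrices of multiplication by the roots *)

Definition kmat := seq (seq kel).
Definition kent (A : kmat) i j := nth k0 (nth [::] A i) j.
Definition kmx m n (f : nat -> nat -> kel) : kmat :=
  [seq [seq f i j | j <- iota 0 n] | i <- iota 0 m].
Definition ksum n (f : nat -> kel) := foldr (fun l => kadd (f l)) k0 (iota 0 n).
(** Skipping zero factors keeps the computations small: the shift matrices are sparse. *)
Definition kmul0 (a b : kel) := if kzero a || kzero b then k0 else kmul a b.
Definition kmmul m k n (A B : kmat) :=
  kmx m n (fun i j => ksum k (fun l => kmul0 (kent A i l) (kent B l j))).
Definition kmeq m n (A B : kmat) :=
  all (fun i => all (fun j => kzero (ksub (kent A i j) (kent B i j))) (iota 0 n))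
    (iota 0 m).

(* If [x_0, ..., x_6] are the roots of the septic in their cyclic order (indices
   mod 7), row [j] lists the coordinates of [98 * x_0 * x_j] on [1, x_0, ..., x_6]. *)
Definition root_products : kmat := [::
  [:: (([:: 0; 196], [::], [::]), ([::], [::], [::]));
      (([:: 84; -70; 14], [::], [::]), ([::], [::], [::]));
      (([:: -14; 28], [:: -42], [:: -7; -7]), ([:: -14; 4], [:: -2], [:: -3]));
      (([:: -14; 21; -7], [:: 7; 7], [:: -35; 7]), ([:: -14; 1], [:: 3], [:: 1]));
      (([:: -14; -14], [:: 35; -7], [:: 42]), ([:: 14; -2], [:: 1], [:: -2]));
      (([:: -14; -14], [:: 35; -7], [:: 42]), ([:: -14; 2], [:: -1], [:: 2]));
      (([:: -14; 21; -7], [:: 7; 7], [:: -35; 7]), ([:: 14; -1], [:: -3], [:: -1]));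
      (([:: -14; 28], [:: -42], [:: -7; -7]), ([:: 14; -4], [:: 2], [:: 3]))];
  [:: (([::], [:: -98], [::]), ([::], [::], [::]));
      (([:: -14; 7; 7], [:: 0; -14], [:: 14; -14]), ([:: -14; 5], [:: -6], [:: -2]));
      (([:: -14; 7; 7], [:: 0; -14], [:: 14; -14]), ([:: 14; -5], [:: 6], [:: 2]));
      (([:: -112; 56; -28], [:: 14; 14], [:: 0; 14]), ([:: 0; 6], [:: -10], [:: -8]));
      (([:: 35; -56; 21], [:: 0; -14], [:: 7; -7]), ([:: 7; -11], [:: 2], [:: 3]));
      (([:: 182; -14], [:: -28; 28], [:: -42; 14]), ([::], [::], [::]));
      (([:: 35; -56; 21], [:: 0; -14], [:: 7; -7]), ([:: -7; 11], [:: -2], [:: -3]));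
      (([:: -112; 56; -28], [:: 14; 14], [:: 0; 14]), ([:: 0; -6], [:: 10], [:: 8]))];
  [:: (([::], [::], [:: -98]), ([::], [::], [::]));
      (([:: -14; 21; -7], [:: -14; 14], [:: -14]), ([:: -14; 3], [:: 2], [:: -4]));
      (([:: 182; -56; 14], [:: 42; -14], [:: 14; 14]), ([::], [::], [::]));
      (([:: -14; 21; -7], [:: -14; 14], [:: -14]), ([:: 14; -3], [:: -2], [:: 4]));
      (([:: 35; -49; 14], [:: -7; 7], [:: -7; -7]), ([:: -7; 8], [:: 3], [:: 1]));
      (([:: -112; 56; -14], [:: 0; -14], [:: 14]), ([:: 0; -2], [:: 8], [:: -2]));
      (([:: -112; 56; -14], [:: 0; -14], [:: 14]), ([:: 0; 2], [:: -8], [:: 2]));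
      (([:: 35; -49; 14], [:: -7; 7], [:: -7; -7]), ([:: 7; -8], [:: -3], [:: -1]))];
  [:: (([:: 0; -98], [:: 98], [:: 98]), ([::], [::], [::]));
      (([:: -14; 7; -7], [:: 14], [:: 0; 14]), ([:: 14; 1], [:: -4], [:: -6]));
      (([:: 35; -56; 7], [:: 7; 7], [:: 0; 14]), ([:: 7; -9], [:: 1], [:: -2]));
      (([:: 35; -56; 7], [:: 7; 7], [:: 0; 14]), ([:: -7; 9], [:: -1], [:: 2]));
      (([:: -14; 7; -7], [:: 14], [:: 0; 14]), ([:: -14; -1], [:: 4], [:: 6]));
      (([:: -112; 70; -14], [:: -14], [:: -14; -14]), ([:: 0; -4], [:: 2], [:: 10]));
      (([:: 182; -42; 28], [:: -14; -14], [:: 28; -28]), ([::], [::], [::]));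
      (([:: -112; 70; -14], [:: -14], [:: -14; -14]), ([:: 0; 4], [:: -2], [:: -10]))]]%BinZ.

(* Since [x_0 * x_(- j) = x_(- j) * x_(- j + j)], the products with [3 < j] are
   obtained by a shift of the indices. *)
Definition root_product j i : kel :=
  if (j <= 3)%N then kent root_products j i else
  if i is i'.+1 then kent root_products (7 - j) ((i' + (7 - j)) %% 7).+1
  else kent root_products (7 - j) 0.

(** Multiplication by [98 * x_0], acting on rows, in the basis [1, x_0, ..., x_5]. The roots have
    sum 0, so [x_6] is minus the sum of the others and its coefficient is subtracted from theirs. *)
Definition mul_x0 : kmat := kmx 7 7 (fun i j =>
  if i is i'.+1 then
    if j is j'.+1 then ksub (root_product i' j) (root_product i' 7) else root_product i' 0
  else if j == 1 then kconst [:: 98]%BinZ else k0).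

(** The cyclic shift in the same basis; the last row is the image [x_6] of [x_5]. *)
Definition shift_roots : kmat := kmx 7 7 (fun i j =>
  if i == 0 then if j == 0 then kconst [:: 1]%BinZ else k0
  else if i == 6 then if j == 0 then k0 else kconst [:: -1]%BinZ
  else if j == i.+1 then kconst [:: 1]%BinZ else k0).

Definition unit_row (c : Z) : kmat := kmx 1 7 (fun _ j =>
  if j == 0 then kconst [:: c] else k0).

Definition unshift_roots : kmat := kmx 7 7 (fun i j =>
  if i == 0 then if j == 0 then kconst [:: 1]%BinZ else k0
  else if i == 1 then if j == 0 then k0 else kconst [:: -1]%BinZ
  else if j == i.-1 then kconst [:: 1]%BinZ else k0).

Definition kid : kmat := kmx 7 7 (fun i j => if i == j then kconst [:: 1]%BinZ else k0).

Definition mul_x1 := kmmul 7 7 7 unshift_roots (kmmul 7 7 7 mul_x0 shift_roots).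

Definition root_row i : kmat := kmx 1 7 (fun _ j =>
  if i == 6 then if j == 0 then k0 else kconst [:: -98]%BinZ
  else if j == i.+1 then kconst [:: 98]%BinZ else k0).

Definition septic_tcoefs : seq tpoly := [::
  [:: -2304; 1536; -816; 184; -23; -1]; [:: 1344; -1232; 476; -126; 7];
  [:: 0; 252; -91; 21]; [:: 84; -28; 28]; [:: -77; 28; -7]; [:: 0; -7]; [::];
  [:: 1]]%BinZ.

(* The scaling by powers of 98 makes the evaluation of the septic at [mul_x0 / 98]
   integral. *)
Fixpoint krow_horner (cs : seq tpoly) : kmat :=
  if cs is c :: cs' then
    let B := kmmul 1 7 7 (krow_horner cs') mul_x0 in
    kmx 1 7 (fun i j => kadd (kent B i j)
      (kscale c (kent (unit_row (Z.pow 98 (Z.of_nat (size cs)))) i j)))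
  else kmx 1 7 (fun _ _ => k0).

Lemma shift_unshift : kmeq 7 7 (kmmul 7 7 7 shift_roots unshift_roots) kid.
Proof. by vm_compute. Qed.

Lemma unit_row_shift : kmeq 1 7 (kmmul 1 7 7 (unit_row 1) shift_roots) (unit_row 1).
Proof. by vm_compute. Qed.

(** The only commutation that is computed; those with the other conjugates follow from it by
    conjugation. *)
Lemma mul_x1_comm :
  let N := mul_x1 in kmeq 7 7 (kmmul 7 7 7 mul_x0 N) (kmmul 7 7 7 N mul_x0).
Proof. by vm_compute. Qed.

Lemma root_row0 : kmeq 1 7 (kmmul 1 7 7 (unit_row 1) mul_x0) (root_row 0).
Proof. by vm_compute. Qed.

Lemma root_rowS : all (fun i =>
  kmeq 1 7 (kmmul 1 7 7 (root_row i) shift_roots) (root_row i.+1)) (iota 0 6).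
Proof. by vm_compute. Qed.

Lemma krow_horner_septic : kmeq 1 7 (krow_horner septic_tcoefs) (kmx 1 7 (fun _ _ => k0)).
Proof. by vm_compute. Qed.

Lemma kent_kmx m n f i j : (i < m)%N -> (j < n)%N -> kent (kmx m n f) i j = f i j.
Proof.
by move=> im jn; rewrite /kent /kmx !(nth_map 0%N) ?size_iota // !nth_iota.
Qed.

Section SepticRoots.

Context {F : fieldExtType rat} {t : int} {y z s : F}.
Hypothesis yy : y ^+ 2 = (14 - 5 * t + 2 * t ^+ 2)%:~R - y + (2 - t)%:~R * z.
Hypothesis yz : y * z = (- 7 + t - t ^+ 2)%:~R + 3 * y + (1 + t)%:~R * z.
Hypothesis zz :
  z ^+ 2 = (14 - 3 * t + t ^+ 2)%:~R + (t - 2)%:~R * y + (t - 3)%:~R * z.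
Hypothesis ss : s ^+ 2 = (- 7 * (t - 1) ^+ 2 - 28)%:~R.

Local Notation ev := (keval t y z s).
Local Notation evM := (kevalM t y z s yy yz zz ss).
Definition kmeval m n (A : kmat) : 'M[F]_(m, n) := \matrix_(i, j) ev (kent A i j).

Lemma ksum_eval n f : ev (ksum n f) = \sum_(l < n) ev (f l).
Proof.
rewrite -(big_mkord xpredT (fun l => ev (f l))) /index_iota subn0 /ksum.
elim: (iota 0 n) => [|l r IHr] /=; first by rewrite big_nil keval0.
by rewrite big_cons kevalD IHr.
Qed.

Lemma kmul0_eval a b : ev (kmul0 a b) = ev a * ev b.
Proof.
rewrite /kmul0 -evM; case: ifP => // /orP[]/(keval0 t y z s) ab0; rewrite keval0 // evM ab0.
  by rewrite mul0r.
by rewrite mulr0.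
Qed.

Lemma kmeval_mul m k n A B : kmeval m n (kmmul m k n A B) = kmeval m k A *m kmeval k n B.
Proof.
apply/matrixP=> i j; rewrite !mxE kent_kmx // ksum_eval.
by apply: eq_bigr => l _; rewrite kmul0_eval !mxE.
Qed.

Lemma kmeval_eq m n A B : kmeq m n A B -> kmeval m n A = kmeval m n B.
Proof.
move=> /allP eqAB; apply/matrixP=> i j; rewrite !mxE.
have /allP/(_ (val j)) : all (fun j => kzero (ksub (kent A i j) (kent B i j))) (iota 0 n).
  by apply: eqAB; rewrite mem_iota ltn_ord.
rewrite mem_iota ltn_ord => /(_ isT)/(keval0 t y z s)/eqP.
by rewrite kevalB subr_eq0 => /eqP.
Qed.

Let M := 98%:R^-1 *: kmeval 7 7 mul_x0.
Let P := kmeval 7 7 shift_roots.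
Let e : 'rV[F]_7 := kmeval 1 7 (unit_row 1).
Let p : {poly F} := map_poly intr (septic t).

Lemma neq98 : 98%:R != 0 :> F. Proof. by rewrite (intr_ext_eq0 F 98). Qed.

Lemma shift_unit : P \in unitmx.
Proof.
suff /mulmx1_unit[] : P *m kmeval 7 7 unshift_roots = 1%:M by [].
rewrite -kmeval_mul (kmeval_eq _ _ _ _ shift_unshift).
apply/matrixP=> i j; rewrite !mxE kent_kmx // -val_eqE.
by case: (val i == val j); rewrite ?kevalC ?keval0 //= mulr0 addr0.
Qed.

Lemma shift_inv : invmx P = kmeval 7 7 unshift_roots.
Proof.
rewrite -[RHS](mulKmx shift_unit) -kmeval_mul (kmeval_eq _ _ _ _ shift_unshift).
rewrite -[LHS]mulmx1; congr (_ *m _).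
apply/matrixP=> i j; rewrite !mxE kent_kmx // -val_eqE.
by case: (val i == val j); rewrite ?kevalC ?keval0 //= mulr0 addr0.
Qed.

Lemma unit_row_fixed k : e *m P ^+ k = e.
Proof.
elim: k => [|k IHk]; first by rewrite expr0 mulmx1.
by rewrite exprSr -mulmxE mulmxA IHk -kmeval_mul (kmeval_eq _ _ _ _ unit_row_shift).
Qed.

Lemma shiftX_unit k : P ^+ k \is a GRing.unit.
Proof. by apply: unitrX; exact: shift_unit. Qed.

(** On rows: shift back [k] times, multiply by [x_0], shift forward again, which is multiplication
    by [x_k]. *)
Let N k := invmx (P ^+ k) *m M *m P ^+ k.

Lemma unit_row_mul_xi k : e *m N k = e *m M *m P ^+ k.
Proof.
by rewrite /N !mulmxA -{1}(unit_row_fixed k) mulmxK //; exact: shiftX_unit.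
Qed.

Lemma mul_x0_x1_comm : comm_mx M (N 1).
Proof.
have N1 : N 1 = 98%:R^-1 *: kmeval 7 7 mul_x1.
  rewrite /N expr1 shift_inv /M -scalemxAr -scalemxAl /mul_x1 !kmeval_mul.
  by rewrite mulmxA.
rewrite N1 /M /comm_mx -!scalemxAl -!scalemxAr -!kmeval_mul.
by rewrite (kmeval_eq _ _ _ _ mul_x1_comm).
Qed.

Lemma unit_row_eval c : kmeval 1 7 (unit_row c) = zinj c *: e.
Proof.
apply/matrixP=> i j; rewrite !mxE !kent_kmx //.
case: eqP => _; first by rewrite !kevalC /=; ring.
by rewrite !keval0 // mulr0.
Qed.

Lemma zinj_pow98 n : zinj (Z.pow 98 (Z.of_nat n)) = 98%:R ^+ n :> F.
Proof.
elim: n => [|n IHn] //; rewrite Nat2Z.inj_succ Z.pow_succ_r ?zinjM ?IHn ?exprS //.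
  by congr (_ * _) => /=; ring.
exact: Nat2Z.is_nonneg.
Qed.

Lemma krow_hornerE cs : kmeval 1 7 (krow_horner cs) =
  98%:R ^+ size cs *: (e *m horner_mx M (Poly (map (teval t) cs))).
Proof.
elim: cs => [|c cs IHcs].
  rewrite /= rmorph0 mulmx0 scaler0; apply/matrixP=> i j.
  by rewrite !mxE kent_kmx // keval0.
rewrite [map _ _]/= [Poly _]/= cons_poly_def rmorphD rmorphM /= horner_mx_X horner_mx_C.
transitivity (kmeval 1 7 (krow_horner cs) *m kmeval 7 7 mul_x0
    + teval t c *: kmeval 1 7 (unit_row (Z.pow 98 (Z.of_nat (size (c :: cs)))))).
  rewrite -kmeval_mul; apply/matrixP=> i j.
  rewrite [krow_horner _]/= mxE kent_kmx // kevalD kevalZ.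
  by rewrite [RHS]mxE [X in _ = _ + X]mxE !mxE.
rewrite unit_row_eval zinj_pow98 IHcs mulmxDr scalerDr; congr (_ + _).
  rewrite /M -scalemxAl mulmxA -[_ *m (_ *: _)]scalemxAr scalerA exprSr.
  by rewrite mulfK ?neq98.
by rewrite mul_mx_scalar !scalerA mulrC.
Qed.

Lemma mul_x0_septic : e *m horner_mx M p = 0.
Proof.
have pE : p = Poly (map (teval t) septic_tcoefs).
  rewrite /p septicE; apply/polyP=> i; rewrite coef_map !coef_Poly.
  do 8 (case: i => [|i]; first by rewrite /=; ring).
  by rewrite /= !nth_nil.
have /eqP := krow_hornerE septic_tcoefs.
rewrite (kmeval_eq _ _ _ _ krow_horner_septic) -pE eq_sym.
have -> : kmeval 1 7 (kmx 1 7 (fun _ _ => k0)) = 0.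
  by apply/matrixP=> i j; rewrite !mxE kent_kmx // keval0.
by rewrite scaler_eq0 expf_eq0 (negPf neq98) andbF => /eqP.
Qed.

Lemma mul_xi_septic k : e *m horner_mx (N k) p = 0.
Proof.
rewrite horner_mx_uconjC ?shiftX_unit //.
have eV : e *m invmx (P ^+ k) = e.
  by rewrite -{1}(unit_row_fixed k) mulmxK //; exact: shiftX_unit.
by rewrite !mulmxA eV mul_x0_septic mul0mx.
Qed.

Lemma eval_root_row i : (i < 7)%N ->
  98%:R *: (e *m N i) = kmeval 1 7 (root_row i).
Proof.
rewrite unit_row_mul_xi /M -scalemxAr -scalemxAl scalerA mulfV ?neq98 // scale1r.
elim: i => [|i IHi] lt_i7.
  by rewrite expr0 mulmx1 -kmeval_mul (kmeval_eq _ _ _ _ root_row0).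
rewrite exprSr -mulmxE mulmxA IHi ?(ltnW lt_i7) // -kmeval_mul.
by apply: kmeval_eq; apply: (allP root_rowS); rewrite mem_iota.
Qed.

Lemma septic_conjugates (L : fieldType) (f : {rmorphism F -> L}) (x : L) :
  irreducible_poly p -> root (map_poly f p) x ->
  exists2 g : 'I_7 -> {poly F}, forall i, root (map_poly f p) (map_poly f (g i)).[x]
    & injective (fun i => (map_poly f (g i)).[x]).
Proof.
move=> p_irr px.
have e_neq0 : e != 0.
  apply: contraTneq (oner_neq0 F) => /matrixP/(_ 0 0); rewrite !mxE kent_kmx // kevalC /=.
  by rewrite mulr0 addr0 => ->; rewrite eqxx.
have size_p : size p = 8%N.
  by rewrite size_map_poly_id0 ?size_septic // (monicP (septic_monic t)) oner_neq0.
(* [N 1 = g(M)] for some polynomial [g]; conjugating by [P ^+ k] gives [N k.+1 = g(N k)], which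
   commutes with [M] when [N k] does. *)
have MN k : comm_mx M (N k).
  have [g gE] := cyclic_commutant p_irr size_p e_neq0 mul_x0_septic _ mul_x0_x1_comm.
  elim: k => [|k IHk]; first by rewrite /N expr0 invmx1 mul1mx mulmx1.
  have -> : N k.+1 = horner_mx (N k) g.
    rewrite horner_mx_uconjC ?shiftX_unit // -gE /N expr1 exprS.
    have -> : invmx (P * P ^+ k) = invmx (P ^+ k) *m invmx P.
      by apply: invrM; [exact: shift_unit | exact: shiftX_unit].
    by rewrite -!mulmxE !mulmxA.
  exact/comm_mx_sym/comm_horner_mx/comm_mx_sym.
apply: (conjugate_roots p_irr size_p e_neq0 mul_x0_septic L f x 7 (fun i => N i) px).
- by move=> i; exact: MN.
- by move=> i; exact: mul_xi_septic.
have lt_neq (i j : 'I_7) : (i < j)%N -> kmeval 1 7 (root_row i) != kmeval 1 7 (root_row j).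
  move=> lt_ij; have lt_i6 : (i < 6)%N by rewrite (leq_trans lt_ij) // -ltnS.
  (* In column [i.+1] row [i] has 98, while row [j] has 0, or -98 if [j = 6]; the difference is 98
     or 196. *)
  apply/eqP => /matrixP/(_ 0 (Ordinal (lt_i6 : i.+1 < 7)%N)); rewrite !mxE !kent_kmx //=.
  rewrite (ltn_eqF lt_i6) !eqxx eqSS (ltn_eqF lt_ij) => /eqP.
  case: (_ == 6%N); rewrite ?kevalC ?keval0 //=.
    rewrite -subr_eq0; apply/negP; rewrite (_ : _ - _ = (196 : int)%:~R) ?intr_ext_eq0 //.
    by ring.
  apply/negP; rewrite (_ : _ + _ = (98 : int)%:~R) ?intr_ext_eq0 //.
  by ring.
move=> i j /(congr1 (fun v => 98%:R *: v)); rewrite !eval_root_row // => eq_ij.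
apply/val_inj; case: (ltngtP i j) => // [/lt_neq|/lt_neq]; rewrite ?eq_ij ?eqxx //.
Qed.

End SepticRoots.

(** * Galois groups *)

Section MinPoly.

Context {L : splittingFieldType rat}.

Lemma map_poly_int_over (U : {subfield L}) (p : {poly int}) :
  map_poly intr p \is a polyOver U.
Proof. by apply/polyOverP => i; rewrite coef_map /= rpred_int. Qed.

Lemma minPoly_int (p : {poly int}) (x : L) : p \is monic ->
  irreducible_poly (map_poly intr p : {poly rat}) ->
  root (map_poly intr p) x -> minPoly 1 x = map_poly intr p.
Proof.
move=> p_monic p_irr px.
have pE : map_poly intr p = map_poly (in_alg L) (map_poly intr p).
  by rewrite -map_poly_comp; apply: eq_map_poly => m; rewrite /= -(rmorph_int (in_alg L)).
have : minPoly 1 x %| map_poly intr p by apply: minPoly_dvdp; rewrite ?map_poly_int_over.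
have /polyOver1P[r rE] := minPolyOver 1 x.
rewrite rE pE dvdp_map => r_dvd.
have r_size : size r != 1 by rewrite -(size_map_poly (in_alg L)) -rE size_minPoly.
have := p_irr.2 _ r_size r_dvd; rewrite -(eqp_map (in_alg L)) -rE -pE.
by rewrite eqp_monic ?monic_minPoly ?monic_map // => /eqP.
Qed.

Lemma adjoin_degree_le (U : {subfield L}) (x : L) (p : {poly L}) :
  p \is a polyOver U -> p != 0 -> root p x -> (adjoin_degree U x < size p)%N.
Proof.
by move=> pU p_neq0 px; rewrite -size_minPoly dvdp_leq // minPoly_dvdp.
Qed.

Lemma char0_separable (U : {subfield L}) x : separable_poly (minPoly U x).
Proof.
apply: pcharf0_separable => l; rewrite !inE; apply/negP => /andP[l_pr].
by rewrite (intr_ext_eq0 L l) eqz_nat => /eqP l0; rewrite l0 in l_pr.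
Qed.

Lemma galois_Fadjoin (U : {subfield L}) (x : L) (rs : seq L) :
  minPoly U x = \prod_(r <- rs) ('X - r%:P) -> {subset rs <= <<U; x>>%VS} ->
  galois U <<U; x>>%AS /\ #|'Gal(<<U; x>>%AS / U)%g| = adjoin_degree U x.
Proof.
move=> min_rs rs_sub.
have galUx : galois U <<U; x>>%AS.
  apply/splitting_galoisField; exists (minPoly U x); split.
  - exact: minPolyOver.
  - exact: char0_separable.
  exists rs; first by rewrite min_rs eqpxx.
  apply/eqP; rewrite eqEsubv; apply/andP; split.
    by apply/Fadjoin_seqP; split; [exact: subv_adjoin | exact: rs_sub].
  apply/FadjoinP; split; first exact: subv_adjoin_seq.
  by apply: seqv_sub_adjoin; rewrite -root_prod_XsubC -min_rs root_minPoly.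
by split; rewrite // -galois_dim // adjoin_degreeE.
Qed.

End MinPoly.

(** A second root of the cubic, obtained by solving for [z] the expression of [y ^+ 2] on [1, y, z];
    hence the denominator [t - 2]. *)
Definition cubic_conj {R : unitRingType} (t : int) (y : R) : R :=
  ((2 * t ^+ 2 - 5 * t + 14)%:~R - y - y ^+ 2) / (t%:~R - 2).

Lemma cubicE t : cubic t = Poly [:: t ^+ 3 + 28; - (2 * t ^+ 2 - 7 * t + 21); - t; 1].
Proof.
apply/polyP=> i; rewrite coef_Poly /cubic !coefE.
do 4 (case: i => [|i] /=; first by rewrite ?mulr0 ?mulr1 ?subr0 ?sub0r ?addr0 ?add0r ?mulr0).
by rewrite ?nth_nil ?mulr0 ?subr0 ?add0r ?addr0.
Qed.

Lemma map_cubicE (R : nzRingType) t : map_poly (intr : int -> R) (cubic t) =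
  Poly [:: (t ^+ 3 + 28)%:~R; (- (2 * t ^+ 2 - 7 * t + 21))%:~R; (- t)%:~R; 1].
Proof.
by rewrite cubicE map_Poly.
Qed.

Section CubicRoots.

Context {R : fieldType} {t : int} {y : R}.
Hypothesis t_neq2 : t%:~R - 2 != 0 :> R.
Hypothesis cubic_y : root (map_poly intr (cubic t)) y.
Local Notation z := (cubic_conj t y).

Lemma cubic_root_eq : y ^+ 3 = t%:~R * y ^+ 2 + (2 * t ^+ 2 - 7 * t + 21)%:~R * y
  - (t ^+ 3 + 28)%:~R.
Proof.
apply/eqP; rewrite -subr_eq0; apply/eqP; rewrite -[RHS](rootP cubic_y).
by rewrite map_cubicE horner_Poly /=; ring.
Qed.

Lemma cubic_conj_sqr :
  y ^+ 2 = (14 - 5 * t + 2 * t ^+ 2)%:~R - y + (2 - t)%:~R * z.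
Proof. by rewrite /cubic_conj; field. Qed.

Lemma cubic_conj_mul :
  y * z = (- 7 + t - t ^+ 2)%:~R + 3 * y + (1 + t)%:~R * z.
Proof.
apply: (mulfI t_neq2); rewrite /cubic_conj.
have -> : (t%:~R - 2) * (y * (((2 * t ^+ 2 - 5 * t + 14)%:~R - y - y ^+ 2) / (t%:~R - 2)))
  = (2 * t ^+ 2 - 5 * t + 14)%:~R * y - y ^+ 2 - y ^+ 3 by field.
by rewrite cubic_root_eq; field.
Qed.

Lemma cubic_conj_conj_sqr :
  z ^+ 2 = (14 - 3 * t + t ^+ 2)%:~R + (t - 2)%:~R * y + (t - 3)%:~R * z.
Proof.
apply: (mulfI t_neq2).
have -> : (t%:~R - 2) * z ^+ 2 = ((2 * t ^+ 2 - 5 * t + 14)%:~R - y - y ^+ 2) * z.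
  by rewrite expr2 mulrA; congr (_ * _); rewrite /cubic_conj mulrC divfK.
have -> : ((2 * t ^+ 2 - 5 * t + 14)%:~R - y - y ^+ 2) * z =
  (2 * t ^+ 2 - 5 * t + 14)%:~R * z - y * z - y * (y * z) by ring.
rewrite cubic_conj_mul !mulrDr.
have -> : y * ((1 + t)%:~R * z) = (1 + t)%:~R * (y * z) by ring.
rewrite cubic_conj_mul [y * (3 * y)]mulrCA -expr2 cubic_conj_sqr; ring.
Qed.

Lemma cubic_factor : map_poly intr (cubic t) =
  \prod_(r <- [:: y; z; t%:~R - y - z]) ('X - r%:P).
Proof.
rewrite !big_cons big_nil mulr1 map_cubicE /= !cons_poly_def.
have e2 : (- (2 * t ^+ 2 - 7 * t + 21))%:~R%:P =
    (y * z + (y + z) * (t%:~R - y - z))%:P :> {poly R}.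
  congr (_%:P).
  have -> : y * z + (y + z) * (t%:~R - y - z) =
    t%:~R * y + t%:~R * z - y ^+ 2 - y * z - z ^+ 2 by ring.
  by rewrite cubic_conj_mul cubic_conj_conj_sqr [in RHS]cubic_conj_sqr; ring.
have e3 : (t ^+ 3 + 28)%:~R%:P = (- (y * z * (t%:~R - y - z)))%:P :> {poly R}.
  congr (_%:P).
  have -> : - (y * z * (t%:~R - y - z)) =
     y * (y * z) + (y * z) * z - t%:~R * (y * z) by ring.
  rewrite !cubic_conj_mul; set a := (- 7 + t - t ^+ 2)%:~R; set b := (1 + t)%:~R.
  have -> : y * (a + 3 * y + b * z) + (a + 3 * y + b * z) * z
      - t%:~R * (a + 3 * y + b * z) =
    a * y + a * z + 3 * y ^+ 2 + (3 + b) * (y * z) + b * z ^+ 2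
      - t%:~R * (a + 3 * y + b * z) by ring.
  by rewrite cubic_conj_mul cubic_conj_conj_sqr [y ^+ 2]cubic_conj_sqr /a /b; ring.
rewrite e3 e2 rmorphN /= !(polyCD, polyCB, polyCM, polyCN); ring.
Qed.

End CubicRoots.

Lemma cubic_cyclic (L : splittingFieldType rat) (t : int) (y : L) : t != 2 ->
  irreducible_poly (map_poly intr (cubic t) : {poly rat}) ->
  root (map_poly intr (cubic t)) y -> cyclic_extension 1%AS <<1; y>>%AS.
Proof.
move=> t_neq2 cubic_irr cubic_y.
have t2 : t%:~R - 2 != 0 :> L.
  by rewrite -[2]/((2 : int)%:~R) -intrB intr_ext_eq0 subr_eq0.
have size_cubic : size (cubic t) = 4%N by rewrite cubicE (PolyK (c := 0)) //= oner_neq0.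
have cubic_monic : cubic t \is monic.
  by rewrite monicE lead_coefE size_cubic cubicE coef_Poly.
have min_y := minPoly_int _ _ cubic_monic cubic_irr cubic_y.
have yE : y \in <<1; y>>%VS := memv_adjoin _ _.
have zE : cubic_conj t y \in <<1; y>>%VS.
  by rewrite rpred_div ?rpredB ?rpredX ?rpred_int ?rpred_nat.
have [|galy card_gal] := galois_Fadjoin _ _ _ (etrans min_y (cubic_factor t2 cubic_y)).
  move=> r; rewrite !inE => /or3P[]/eqP-> //.
  by rewrite !rpredB ?rpred_int.
split=> //; apply: prime_cyclic; rewrite card_gal.
suff -> : adjoin_degree 1%AS y = 3%N by [].
apply: succn_inj; rewrite -size_minPoly min_y size_map_poly_id0 //.
by rewrite (monicP cubic_monic) oner_neq0.
Qed.

Section SepticGalois.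

Context {L : splittingFieldType rat} {t : int} {s y : L}.
Hypothesis t_neq2 : t != 2.
Hypothesis ss : s ^+ 2 = (- 7 * (t - 1) ^+ 2 - 28)%:~R.
Hypothesis cubic_y : root (map_poly intr (cubic t)) y.
Hypothesis septic_irr : irreducible_poly (map_poly intr (septic t) : {poly rat}).
Local Notation K := <<1 & [:: s; y]>>%AS.
Local Notation p := (map_poly intr (septic t) : {poly L}).

Lemma septicL_monic : p \is monic.
Proof. by apply: monic_map; exact: septic_monic. Qed.

Lemma size_septicL : size p = 8%N.
Proof. by rewrite size_map_poly_id0 ?size_septic // (monicP (septic_monic t)) oner_neq0. Qed.

Lemma base_dim_coprime7 : ~~ (7 %| \dim K)%N.
Proof.
rewrite /= adjoin_cons adjoin_seq1 !dim_Fadjoin dimv1 muln1.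
have s_le : (adjoin_degree 1 s < 3)%N.
  have := @adjoin_degree_le L 1%AS s ('X^2 - (s ^+ 2)%:P).
  rewrite size_XnsubC //; apply.
  - by rewrite rpredB ?rpredX ?polyOverX // polyOverC ss rpred_int.
  - by rewrite -size_poly_eq0 size_XnsubC.
  - by rewrite /root hornerD hornerN hornerXn hornerC subrr.
have y_le : (adjoin_degree <<1; s>>%AS y < 4)%N.
  have := @adjoin_degree_le L <<1; s>>%AS y _ (map_poly_int_over _ (cubic t)) _ cubic_y.
  have -> : size (map_poly intr (cubic t) : {poly L}) = 4%N.
    by rewrite map_cubicE (PolyK (c := 0)) //= oner_neq0.
  by apply; rewrite -size_poly_eq0 map_cubicE (PolyK (c := 0)) //= oner_neq0.
rewrite Euclid_dvdM // negb_or; apply/andP; split.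
  by apply: contraL y_le => /dvdn_leq le7; rewrite -leqNgt (leq_trans _ (le7 _)).
by apply: contraL s_le => /dvdn_leq le7; rewrite -leqNgt (leq_trans _ (le7 _)).
Qed.

(** The number 7 divides the degree of [K(x)] over the rationals but not that of [K], so it divides
    the degree of [x] over [K], which is at most 7. *)
Lemma minPoly_septic x : root p x -> minPoly K x = p.
Proof.
move=> px; have p_over : p \is a polyOver K := map_poly_int_over _ _.
have deg1 : adjoin_degree 1%AS x = 7%N.
  apply: succn_inj; rewrite -size_minPoly (minPoly_int _ _ _ septic_irr px) ?septic_monic //.
  by rewrite size_septicL.
have dvd7 : (7 %| adjoin_degree K x)%N.
  have : (7 %| \dim <<K; x>>)%N.
    have <- : \dim <<1; x>> = 7%N by rewrite dim_Fadjoin deg1 dimv1.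
    by apply: field_dimS; apply: adjoinSl; exact: sub1v.
  by rewrite dim_Fadjoin Euclid_dvdM // (negPf base_dim_coprime7) orbF.
have p_dvd : minPoly K x %| p by apply: minPoly_dvdp.
apply/eqP; rewrite -eqp_monic ?monic_minPoly ?septicL_monic //.
rewrite -(dvdp_size_eqp p_dvd) size_septicL size_minPoly eqSS eqn_leq.
rewrite [(7 <= _)%N]dvdn_leq // andbT.
rewrite -ltnS -size_minPoly -size_septicL dvdp_leq //.
by rewrite monic_neq0 ?septicL_monic.
Qed.

Lemma septic_irr_base x : root p x ->
  irreducible_poly (map_poly intr (septic t) : {poly subvs_of K}).
Proof.
move=> px; have pE : map_poly vsval (map_poly intr (septic t) : {poly subvs_of K}) = p.
  by rewrite -map_poly_comp; apply: eq_map_poly => m; exact: (rmorph_int vsval).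
split; first by rewrite -(size_map_poly vsval) pE size_septicL.
move=> r r_size; rewrite -(dvdp_map vsval) -(eqp_map vsval) pE -{1}(minPoly_septic x px) => r_dvd.
have r_over : map_poly vsval r \is a polyOver K.
  by apply/polyOverP => i; rewrite coef_map subvsP.
case/orP: (minPoly_irr r_over r_dvd); first by rewrite minPoly_septic.
by rewrite -size_poly_eq1 size_map_poly (negPf r_size).
Qed.

Lemma septic_roots x : root p x -> exists rs : seq L,
  [/\ p = \prod_(r <- rs) ('X - r%:P), size rs = 7%N & {subset rs <= <<K; x>>%VS}].
Proof.
move=> px; have p_irr := septic_irr_base x px.
have pE : map_poly vsval (map_poly intr (septic t) : {poly subvs_of K}) = p.
  by rewrite -map_poly_comp; apply: eq_map_poly => m; exact: (rmorph_int vsval).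
have sK : s \in K by apply: seqv_sub_adjoin; rewrite mem_head.
have yK : y \in K by apply: seqv_sub_adjoin; rewrite !inE eqxx orbT.
pose s' : subvs_of K := Subvs sK; pose y' : subvs_of K := Subvs yK.
have t2 : t%:~R - 2 != 0 :> subvs_of K.
  by rewrite -[2]/((2 : int)%:~R) -intrB intr_ext_eq0 subr_eq0.
have cubic_y' : root (map_poly intr (cubic t)) y'.
  have := cubic_y; rewrite -[y]/(vsval y') -(fmorph_root vsval) -map_poly_comp.
  congr (root _ _); apply: eq_map_poly => m; symmetry; exact: (rmorph_int vsval).
have ss' : s' ^+ 2 = (- 7 * (t - 1) ^+ 2 - 28)%:~R.
  by apply: (fmorph_inj vsval); rewrite rmorphXn rmorph_int.
have [g g_root g_inj] := septic_conjugates (cubic_conj_sqr t2) (cubic_conj_mul t2 cubic_y')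
  (cubic_conj_conj_sqr t2 cubic_y') ss' L vsval x p_irr (etrans (congr1 (root^~ x) pE) px).
pose rs := [seq (map_poly vsval (g i)).[x] | i <- enum 'I_7].
have size_rs : size rs = 7%N by rewrite size_map size_enum_ord.
exists rs; split=> //.
  rewrite (all_roots_prod_XsubC (p := p) (rs := rs)) ?size_rs ?size_septicL //.
  - by rewrite (monicP septicL_monic) scale1r.
  - by apply/allP => _ /mapP[i _ ->]; rewrite -pE.
  - by rewrite uniq_rootsE map_inj_uniq // enum_uniq.
move=> _ /mapP[i _ ->]; rewrite -[_.[x]]/(_.[x]); apply: mempx_Fadjoin.
by apply/polyOverP => j; rewrite coef_map subvsP.
Qed.

Lemma septic_splitting (E : {subfield L}) : splittingFieldFor K p E ->
  exists rs : seq L, [/\ p = \prod_(r <- rs) ('X - r%:P), size rs = 7%N,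
    {in rs, forall x, E = <<K; x>>%AS}, galois K E & #|'Gal(E / K)%g| = 7%N].
Proof.
case=> rs' p_rs' E_rs'.
have {}p_rs' : p = \prod_(r <- rs') ('X - r%:P).
  by apply/eqP; rewrite -eqp_monic ?septicL_monic ?monic_prod_XsubC.
have size_rs' : size rs' = 7%N.
  by apply: succn_inj; rewrite -size_septicL p_rs' size_prod_XsubC.
have EE x : x \in rs' -> E = <<K; x>>%AS.
  move=> x_rs'; have px : root p x by rewrite p_rs' root_prod_XsubC.
  have [rs [p_rs _ rs_sub]] := septic_roots x px.
  apply/val_inj/eqP; rewrite /= -E_rs' eqEsubv; apply/andP; split.
    apply/Fadjoin_seqP; split; first exact: subv_adjoin.
    by move=> r r_rs'; apply: rs_sub; rewrite -root_prod_XsubC -p_rs p_rs' root_prod_XsubC.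
  by apply/FadjoinP; split; [exact: subv_adjoin_seq | exact: seqv_sub_adjoin].
have [x x_rs'] : exists x, x \in rs'.
  by case: rs' size_rs' {p_rs' E_rs' EE} => // x r _; exists x; rewrite mem_head.
have px : root p x by rewrite p_rs' root_prod_XsubC.
have [rs [p_rs _ rs_sub]] := septic_roots x px.
have min_x := minPoly_septic x px.
have [galE cardE] := galois_Fadjoin K x rs (etrans min_x p_rs) rs_sub.
exists rs'; split=> //; rewrite ?(EE x x_rs') // cardE.
by apply: succn_inj; rewrite -size_minPoly min_x size_septicL.
Qed.

End SepticGalois.

(** * Unramifiedness *)

(** Embeddings into [algC] are defined on the type [subvs_of E] only, so polynomial expressions in
    [x] over [K] have to be available inside that type. *)
Lemma subvs_poly (L : splittingFieldType rat) (K E : {subfield L}) (x : L) :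
  E = <<K; x>>%AS -> forall w : subvs_of E, exists2 r : {poly subvs_of E},
    (forall i, vsval r`_i \in K) & w = r.[vsproj E x].
Proof.
move=> EE w; have E_sub : {subset E <= <<K; x>>%VS} by move=> v; rewrite EE.
have xE : x \in E by rewrite EE memv_adjoin.
have sKE : (K <= E)%VS by rewrite EE subv_adjoin.
have r_over := Fadjoin_polyOver K x (vsval w).
exists (map_poly (vsproj E) (Fadjoin_poly K x (vsval w))).
  move=> i; rewrite coef_map /= vsprojK; first exact: (polyOverP r_over).
  by apply: (subvP sKE); exact: (polyOverP r_over).
apply: val_inj; rewrite -[LHS]/(vsval w) -[RHS]/(vsval _) -horner_map /= vsprojK //.
have -> : map_poly vsval (map_poly (vsproj E) (Fadjoin_poly K x (vsval w))) =
    Fadjoin_poly K x (vsval w).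
  apply/polyP=> i; rewrite !coef_map /= vsprojK //.
  by apply: (subvP sKE); exact: (polyOverP r_over).
by rewrite Fadjoin_poly_eq // E_sub ?subvsP.
Qed.

(* If [f] is real on [K], then complex conjugation acts on [f E] as an element of
   [Gal(E / K)] of order at most 2. *)
Lemma unramified_infinite_odd (L : splittingFieldType rat) (K E : {subfield L})
    (P : {poly int}) (x : L) (rs : seq L) :
  galois K E -> odd #|'Gal(E / K)%g| -> E = <<K; x>>%AS ->
  map_poly intr P = \prod_(r <- rs) ('X - r%:P) -> minPoly K x = map_poly intr P ->
  {subset rs <= E} -> unramified_at_infinite_places K E.
Proof.
move=> galKE oddG EE P_rs min_x rs_E f f_real w.
have xE : x \in E by rewrite EE memv_adjoin.
pose X := vsproj E x.
have root_conj r : r \in rs -> exists2 g, g \in 'Gal(E / K)%g & g x = r.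
  move=> r_rs; case/and3P: galKE => sKE _ normKE.
  by apply: normalField_root_minPoly; rewrite // min_x P_rs root_prod_XsubC.
have [r r_rs conjX] : exists2 r, r \in rs & (f X)^* = f (vsproj E r).
  have PE : map_poly intr P = \prod_(r <- rs) ('X - (vsproj E r)%:P).
    apply: (map_poly_inj vsval); rewrite -map_poly_comp map_prod_XsubC.
    rewrite (@eq_map_poly _ _ _ intr) ?P_rs => [|m]; last exact: (rmorph_int vsval).
    by apply: eq_big_seq => r r_rs; rewrite /= vsprojK // rs_E.
  have PC : map_poly intr P = \prod_(r <- [seq f (vsproj E r) | r <- rs]) ('X - r%:P).
    rewrite big_map -map_prod_XsubC -PE -map_poly_comp.
    by apply: eq_map_poly => m /=; rewrite rmorph_int.
  have : root (map_poly intr P) (f X)^*.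
    have -> : map_poly intr P = map_poly Num.conj (map_poly intr P : {poly algC}).
      by rewrite -map_poly_comp; apply: eq_map_poly => m /=; rewrite rmorph_int.
    rewrite fmorph_root PC root_prod_XsubC; apply/mapP; exists x => //.
    by rewrite -root_prod_XsubC -P_rs -min_x root_minPoly.
  by rewrite PC root_prod_XsubC => /mapP[r r_rs ->]; exists r.
have [g gG gx] := root_conj r r_rs.
pose gE (v : subvs_of E) := vsproj E (g (vsval v)).
(* The two sides agree at [x] by the choice of [g], and on [K] because [f] is real there; [x]
   generates [E] over [K]. *)
have f_gE v : f (gE v) = (f v)^*.
  have [a a_K vE] := subvs_poly _ _ _ _ EE v.
  have -> : gE v = a.[vsproj E r].
    apply: val_inj; rewrite -[LHS]/(vsval _) -[RHS]/(vsval _) vsprojK ?memv_gal ?subvsP //.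
    rewrite vE -!horner_map /= (vsprojK xE) (vsprojK (rs_E r r_rs)) -gx.
    have a_over : map_poly vsval a \is a polyOver K.
      by apply/polyOverP => i; rewrite coef_map; exact: a_K.
    by case/and3P: galKE => sKE _ _; rewrite (fixedPoly_gal sKE gG a_over).
  rewrite vE -!horner_map /= -/X conjX; congr (_.[_]).
  apply/polyP => i; rewrite !coef_map /=; symmetry; apply: CrealP.
  by apply: f_real; exact: a_K.
have g2 : (g * g = 1)%g.
  apply/eqP/gal_eqP => v vE; rewrite galM // gal_id.
  have := f_gE (gE (vsproj E v)); rewrite [in RHS]f_gE conjCK => /fmorph_inj/(congr1 vsval).
  by rewrite /gE !vsprojK ?memv_gal.
have g1 : g = 1%g.
  have g_dvdG := order_dvdG gG.
  have g_dvd2 : (#[g]%g %| 2)%N by rewrite order_dvdn expgS expg1 g2.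
  apply/eqP; rewrite -order_eq1 -dvdn1.
  have /eqP <- : coprime #|'Gal(E / K)%g| 2 by rewrite coprimen2.
  by rewrite dvdn_gcd g_dvdG.
apply/CrealP; rewrite -f_gE /gE g1 gal_id; congr (f _).
by apply: val_inj; rewrite /= vsprojK ?subvsP.
Qed.

Lemma gal_pow_cong (L : splittingFieldType rat) (E : {subfield L}) (q : set L)
    (tau : gal_of E) k : prime_ideal E q ->
  (forall z, ring_of_integers E z -> q (tau z - z)) ->
  forall z, ring_of_integers E z -> q ((tau ^+ k)%g z - z).
Proof.
move=> qP tau_cong z Oz; elim: k => [|k IHk].
  by rewrite expg0 gal_id subrr; exact: (pideal0 qP).
rewrite expgSr galM ?(oi_mem Oz) // -[_ - z](subrKA ((tau ^+ k)%g z)).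
by apply: (pidealD qP) => //; apply/tau_cong/oi_gal.
Qed.

Theorem theorem12 (t : int) (L : splittingFieldType rat)
  (ht : [\/ (t = 3 %[mod 7])%Z,
            [\/ (t = -17 %[mod 49])%Z, (t = -5 %[mod 49])%Z,
                (t = 5 %[mod 49])%Z
              | (t = 7 %[mod 49])%Z \/ (t = 13 %[mod 49])%Z]
          | (t = 743 %[mod 2401])%Z])
  (hcubic : irreducible_poly (map_poly intr (cubic t) : {poly rat})) :
  (forall y : L, root (map_poly intr (cubic t)) y ->
     cyclic_extension 1%AS <<1; y>>%AS) /\
  (irreducible_poly (map_poly intr (septic t) : {poly rat}) ->
   forall (s y : L) (E : {subfield L}),
     s ^+ 2 = (- 7 * (t - 1) ^+ 2 - 28)%:~R ->
     root (map_poly intr (cubic t)) y ->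
     let K : {subfield L} := <<1 & [:: s; y]>>%AS in
     splittingFieldFor K (map_poly intr (septic t)) E ->
     cyclic_extension K E /\ unramified_extension K E).
Proof.
(* None of the residue classes contains 2, the value at which [cubic_conj] degenerates. *)
have t_neq2 : t != 2.
  by apply/negP => /eqP t2; case: ht => [|[|||[]]|] /eqz_mod_eq[k]; lia.
have slopes : adic_slopes t.
  case: ht => [|[|||[]]|].
  - exact: adic_slopes_3_7.
  - exact: adic_slopes_m17_49.
  - exact: adic_slopes_m5_49.
  - exact: adic_slopes_5_49.
  - exact: adic_slopes_7_49.
  - exact: adic_slopes_13_49.
  exact: adic_slopes_743_2401.
split=> [y|]; first exact: cubic_cyclic.
move=> septic_irr s y E ss cubic_y K splitE.
have [rs [p_rs size_rs EE galKE cardG]] :=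
  septic_splitting t_neq2 ss cubic_y septic_irr E splitE.
have [x x_rs] : exists x, x \in rs.
  by case: rs size_rs {p_rs EE} => // x r _; exists x; rewrite mem_head.
have px : root (map_poly intr (septic t)) x by rewrite p_rs root_prod_XsubC.
have min_x := minPoly_septic ss cubic_y septic_irr x px.
have rs_E : {subset rs <= E} by move=> r /EE->; exact: memv_adjoin.
have G_prime : prime #|'Gal(E / K)%g| by rewrite cardG.
split; first by split=> //; exact: prime_cyclic.
split; last first.
  apply: (unramified_infinite_odd L K E (septic t) x rs) => //; last exact: EE.
  by rewrite cardG.
move=> q qP q_neq0; apply: (ramification_index1 galKE qP q_neq0) => tau tauG tau1.
apply: contrapT => tau_triv.
have tau_cong z : ring_of_integers E z -> q (tau z - z).
  by move=> Oz; apply: contrapT => nq; apply: tau_triv; exists z.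
(* The group has order 7, so one nontrivial inert [tau] generates it and every automorphism is
   trivial modulo [q]. *)
have tau_gen : (<[tau]> = 'Gal(E / K))%g.
  apply/eqP; rewrite eqEcard cycle_subG tauG /=.
  have /primeP[_ /(_ _ (order_dvdG tauG))] := G_prime.
  by rewrite order_eq1 (negPf tau1) => /eqP <-.
have rs_cong a b : a \in rs -> b \in rs ->
    exists2 g : gal_of E, g a = b & forall z, ring_of_integers E z -> q (g z - z).
  move=> a_rs b_rs; have [g gG gab] : exists2 g, g \in 'Gal(E / K)%g & g a = b.
    case/and3P: galKE => sKE _ normKE; apply: normalField_root_minPoly; rewrite ?rs_E //.
    by rewrite (minPoly_septic ss cubic_y septic_irr) ?p_rs root_prod_XsubC.
  move: gG; rewrite -tau_gen => /cycleP[k g_eq]; exists g => // z Oz.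
  by rewrite g_eq; exact: gal_pow_cong.
exact: (congruent_roots_slopes qP p_rs size_rs rs_E rs_cong slopes).
Qed.
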